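(* Let $\psi:\mathbb{R}\to\mathbb{R}$ satisfy: 1. $\psi\in C^1(\mathbb{R})$; 2. the functions $t\mapsto\psi(t)$, $t\mapsto\sqrt{t}\,\psi(t)$ and $t\mapsto t\,\psi(t)$ are in $L^1((0,\infty))$; 3. $\psi$ is even and non-negative, with $\psi(0)=1$. Set $$k_\psi(t):=1-\int_0^t u\,\mathcal{H}_0(\psi)(u)\,du,\qquad t\ge 0,$$ and suppose that $(k_\psi)^{-1}\in L^1_{loc}((0,1))$. Let $U$ be a random variable uniformly distributed in $[0,1]$ and, for $n=0,1,2,\dots$, let $V_n:=(k_\psi)^{-1}(U)\,\sin(nU)$. Then the sequence of random variables $V_n$ converges in law, as $n\to\infty$, to a random variable $V$ having $\frac{1}{\sqrt{2\pi}}\mathcal{F}_1(\psi)$ as probability density function.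
   Context: $J_0$ is the Bessel function of the first kind of order $0$: $J_0(x)=\frac{1}{2\pi}\int_{-\pi}^{\pi}e^{ix\sin(u)}\,du$ for $x\in\mathbb{R}$. The Hankel transform of order $0$ of a function $g$ on $(0,+\infty)$ with $x\mapsto x g(x)\in L^1((0,+\infty))$ is $\mathcal{H}_0(g)(t)=\int_0^\infty g(r)J_0(rt)\,r\,dr$, $t\in\mathbb{R}$; $\mathcal{H}_0(\psi)$ means $\mathcal{H}_0$ applied to the restriction of $\psi$ to $(0,+\infty)$. $(k_\psi)^{-1}:(0,1)\to(0,+\infty)$ denotes the inverse function of $k_\psi$; it is asserted, as a consequence of conditions 1-3 and the Hankel inversion formula $\psi=\mathcal{H}_0(\mathcal{H}_0(\psi))$ on $[0,+\infty)$, that $k_\psi$ is a decreasing bijection from $(0,+\infty)$ to $(0,1)$. The Fourier transform of $\psi\in L^1(\mathbb{R})$ is $\mathcal{F}_1(\psi)(y)=\frac{1}{\sqrt{2\pi}}\int_{\mathbb{R}}\psi(x)e^{-ixy}\,dx$. $L^1_{loc}((0,1))$ is the set of functions that are Lebesgue integrable on every compact subset of the open interval $(0,1)$. Convergence in law means convergence in distribution.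
   Formalization: That k_ψ is a bijection from (0,∞) onto (0,1) is assumed, not derived from 1-3: it does not follow from them, e.g. ψ(x)=(1+10x²)exp(-x²) satisfies 1-3 but k_ψ takes negative values, so the inverse is undefined. *)

(* Defs.v *)
From mathcomp Require Import all_boot all_order all_algebra.
From mathcomp Require Import all_classical all_reals all_analysis.
From mathcomp Require Import complex.

Set Implicit Arguments.
Unset Strict Implicit.
Unset Printing Implicit Defensive.

Import Order.TTheory GRing.Theory Num.Theory.
Import numFieldNormedType.Exports.

Local Open Scope classical_set_scope.
Local Open Scope ring_scope.
Local Open Scope complex_scope.

Local Notation mu := lebesgue_measure.

(* e^{it} *)
Definition expi (R : realType) (t : R) : R[i] := cos t +i* sin t.

Definition Cintegral (R : realType) (D : set R) (f : R -> R[i]) : R[i] :=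
  (\int[mu]_(x in D) complex.Re (f x)) +i* (\int[mu]_(x in D) complex.Im (f x)).

Definition besselJ0C (R : realType) (x : R) : R[i] :=
  ((2 * pi)^-1)%:C * Cintegral `[- pi, pi] (fun u => expi (x * sin u)).

(* besselJ0C is real-valued, see besselJ0CE below. *)
Definition besselJ0 (R : realType) (x : R) : R := complex.Re (besselJ0C x).

Lemma besselJ0CE (R : realType) (x : R) : besselJ0C x = (besselJ0 x)%:C.
Proof.
rewrite /besselJ0 /besselJ0C /Cintegral /expi.
set I := Rintegral _ _ _; set J := Rintegral _ _ _.
suff -> : J = 0 by apply/eqP; rewrite eq_complex /= !mulr0 mul0r addr0 !eqxx.
suff /eqP : J = - J by rewrite -addr_eq0 -mulr2n mulrn_eq0 => /orP[]// /eqP.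
pose s u : R := sin (x * sin u).
have cs : continuous s.
  move=> u; apply: continuous_comp; last exact: continuous_sin.
  by apply: cvgM; [exact: cvg_cst|exact: continuous_sin].
have piN : (- pi <= pi :> R) by rewrite ge0_cp ?pi_ge0.
have ints : mu.-integrable `[- pi, pi] (EFin \o s).
  apply: continuous_compact_integrable; first exact: segment_compact.
  exact: continuous_subspaceT.
rewrite {1}/J -[LHS]/(\int[mu]_(u in `[- pi, pi]) s u) /Rintegral.
have := @integration_by_substitution_oppr R s (- pi) pi piN.
rewrite opprK => ->; last exact: continuous_subspaceT.
transitivity (\int[mu]_(u in `[- pi, pi]) (- 1 * s u)).
  apply: eq_Rintegral => u _ /=.
  by rewrite /s sinN mulrN sinN mulN1r.
by rewrite RintegralZl// mulN1r.
Qed.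

Definition hankel0 (R : realType) (g : R -> R) (t : R) : R :=
  \int[mu]_(r in `]0, +oo[) (g r * besselJ0 (r * t) * r).

Definition fourier1 (R : realType) (psi : R -> R) (y : R) : R[i] :=
  ((Num.sqrt (2 * pi))^-1)%:C *
  Cintegral setT (fun x => (psi x)%:C * expi (- (x * y))).

Definition kfun (R : realType) (psi : R -> R) (t : R) : R :=
  1 - \int[mu]_(u in `[0, t]) (u * hankel0 psi u).

(* The inverse of kfun psi : ]0, +oo[ -> ]0, 1[ when the latter is a bijection,
   extended by 0 outside of the image. *)
Definition kinv (R : realType) (psi : R -> R) : R -> R :=
  'pinv_(fun=> 0) `]0, +oo[ (kfun psi).

Lemma kinvP (R : realType) (psi : R -> R) :
  set_bij `]0, +oo[ `]0, 1[ (kfun psi) ->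
  [/\ set_bij `]0, 1[ `]0, +oo[ (kinv psi),
      {in `]0, +oo[%classic, cancel (kfun psi) (kinv psi)},
      {in `]0, 1[%classic, cancel (kinv psi) (kfun psi)} &
      forall y, y \notin `]0, 1[%classic -> kinv psi y = 0].
Proof.
move=> kb; split.
- exact: bijpinv_bij.
- exact/pinvKV/set_bij_inj/kb.
- exact/surjpK/set_bij_surj/kb.
move=> y; rewrite notin_setE => yN; rewrite /kinv /pinv_ splitV.
case E: ('oinv_[fun kfun psi in `]0, +oo[%classic] y) => [x|//].
have [im|nim] := pselect ((kfun psi @` `]0, +oo[%classic) y).
  by case: yN; case: im => z zA <-; case: kb => + _ _; exact.
have := oinv_surj
  ((fun _ => id) : set_surj `]0, +oo[ (kfun psi @` `]0, +oo[) (kfun psi)) y.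
by case: pselect => // _ H; move: E; rewrite [LHS]H.
Qed.

Definition C1 (R : realType) (f : R -> R) : Prop :=
  (forall x, derivable f x 1) /\ continuous (derive1 f).

Definition has_density d (T : measurableType d) (R : realType)
    (P : probability T R) (V : {RV P >-> R}) (f : R -> R) : Prop :=
  [/\ measurable_fun setT f, forall y, 0 <= f y &
      forall A, measurable A ->
        distribution P V A = (\int[mu]_(y in A) (f y)%:E)%E].

Definition cvg_in_law (R : realType)
    d (T : measurableType d) (P : probability T R) (X : nat -> {RV P >-> R})
    d' (T' : measurableType d') (P' : probability T' R) (Y : {RV P' >-> R}) :
    Prop :=
  forall g : R -> R, continuous g -> bounded_fun g ->
    ('E_P[g \o X n] @[n --> \oo] --> 'E_P'[g \o Y])%E.

(* Main.v *)
Require Import Defs.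
From HB Require Import structures.
From mathcomp Require Import all_boot all_order all_algebra.
From mathcomp Require Import all_classical all_reals all_analysis.
From mathcomp Require Import complex ring lra measurable_realfun.
Import Order.TTheory GRing.Theory Num.Theory.
Import numFieldNormedType.Exports.
Local Open Scope classical_set_scope.
Local Open Scope ring_scope.
Set Implicit Arguments.
Unset Strict Implicit.
Unset Printing Implicit Defensive.

(* Proof idea. With K the inverse of k and f(y) = (2 pi)^-1 int psi(x) cos(xy) dx,
   equidistribution of n u mod 2 pi makes K(U) sin(nU) converge in law to
   V = K(U) sin(S), where S is uniform on [-pi, pi] and independent of U.
   It remains to see that V has density f, and for this it is enough to test
   both laws on the Gaussians exp(-b y^2/2): they are symmetric, and limits of
   linear combinations of Gaussians include the indicators of {|y| > a}.  This
   also yields f >= 0, which is not known beforehand.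
   The Gaussian means agree by Weber's formula
   int_0^oo u exp(-b u^2/2) J_0(ru) du = b^-1 exp(-r^2/(2b)), which gives the mean
   of exp(-b K(U)^2/2), and by sin(S)^2 being distributed as 1/(1+x^2) for x a
   Cauchy variable, which turns the mean over S into a Gaussian integral. *)

(** * Affine substitutions, Fubini and dominated convergence for real integrals *)

(** Formally E exp(itV) = E J_0(t K(U)) = int x H_0(psi)(x) J_0(tx) dx = psi(t) by Hankel inversion,
    and Fourier inversion then gives f. Gaussian tests bypass both inversions: Fourier and Hankel
    transforms send Gaussians to Gaussians, and every exchange of integrals concerns either
    nonnegative functions or functions dominated by a product. The two sides meet as follows.
    Writing sin(S)^2 = 1/(1+x^2) replaces b by b/(1+x^2), so Weber's formula produces
    exp(-r^2(1+x^2)/(2b)) with the weight r. Integrating over x gives a factor proportional to 1/r,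
    which cancels the weight and leaves the integral of psi(r) exp(-r^2/(2b)), that is, the Gaussian
    mean of f up to a constant. As f is at first only continuous, bounded and even, f(y) dy is not
    yet a measure; a factor exp(-c y^2/2) stays in all test functions until f >= 0 is proved, and is
    then removed by letting c tend to 0. *)

Section affine.
Context {R : realType}.
Local Notation mu := (@lebesgue_measure R).
Implicit Types (a b : R) (f : R -> R).

Lemma measurable_affine a b : measurable_fun setT (fun x => a * x + b).
Proof. by apply: measurable_funD => //; exact: measurable_funM. Qed.

Lemma preimage_affine_itv a b x y : a != 0 ->
  mu ((fun t => a * t + b) @^-1` `]x, y]) = (`|a|^-1%:E * mu `]x, y])%E.
Proof.
move=> a0; rewrite lebesgue_measure_itv/= lte_fin.
have [lt_a0|a_gt0|//] := ltgtP a 0; last by move/eqP: a0.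
  have -> : (fun t => a * t + b) @^-1` `]x, y] =
      `[(y - b) / a, (x - b) / a[%classic.
    apply/seteqP; split => t /=; rewrite !in_itv/= ltr_ndivlMr// ler_ndivrMr//.
      by move=> /andP[? ?]; apply/andP; split; lra.
    by move=> /andP[? ?]; apply/andP; split; lra.
  rewrite lebesgue_measure_itv/= lte_fin ltr_nM2r ?invr_lt0// ltrD2r.
  case: ifPn => xy; last by rewrite mule0.
  rewrite -!EFinD -EFinM ltr0_norm//; congr EFin.
  by field.
have -> : (fun t => a * t + b) @^-1` `]x, y] =
    `](x - b) / a, (y - b) / a]%classic.
  apply/seteqP; split => t /=; rewrite !in_itv/= ltr_pdivrMr// ler_pdivlMr//.
    by move=> /andP[? ?]; apply/andP; split; lra.
  by move=> /andP[? ?]; apply/andP; split; lra.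
rewrite lebesgue_measure_itv/= lte_fin ltr_pM2r ?invr_gt0// ltrD2r.
case: ifPn => xy; last by rewrite mule0.
rewrite -!EFinD -EFinM gtr0_norm//; congr EFin.
by field.
Qed.

(** The pushforward of [mu] under the affine map, multiplied by [|a|], gives every half-open
    interval its length, hence is [mu] by uniqueness of Lebesgue measure. *)
Lemma ge0_integral_affine a b (f : R -> \bar R) : a != 0 ->
  measurable_fun setT f -> (forall x, 0 <= f x)%E ->
  (\int[mu]_x f x = `|a|%:E * \int[mu]_x f (a * x + b)%R)%E.
Proof.
move=> a0 mf f0.
pose phi : measurableTypeR R -> measurableTypeR R := fun x : R => a * x + b.
have mphi : measurable_fun setT phi by exact: measurable_affine.
pose nu := pushforward mu phi : {measure set (measurableTypeR R) -> \bar R}.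
pose m : {measure set (measurableTypeR R) -> \bar R} := mscale (NngNum (normr_ge0 a)) (nu mphi).
have mum X : ocitv X -> mu X = m X.
  move=> [[x y] _ <-].
  transitivity (`|a|%:E * mu ((fun t => (a * t + b)%R) @^-1` `]x, y]))%E => //.
  rewrite (@preimage_affine_itv a b x y a0) muleA -EFinM divff ?mul1e//.
  by rewrite normr_eq0.
transitivity (\int[m]_x f x)%E.
  apply: (@eq_measure_integral _ (measurableTypeR R) R setT m mu f) => A mA _.
  exact: (@lebesgue_measure_unique _ m mum).
rewrite ge0_integral_mscale//=; congr (_ * _)%E.
by rewrite ge0_integral_pushforward.
Qed.

Lemma integrable_affine a b f : a != 0 ->
  mu.-integrable setT (EFin \o f) ->
  mu.-integrable setT (fun x => (f (a * x + b))%:E).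
Proof.
move=> a0 /integrableP[/measurable_EFinP mf foo].
have maf : measurable_fun setT (fun x => f (a * x + b)).
  exact: measurableT_comp mf (measurable_affine a b).
apply/integrableP; split; first exact/measurable_EFinP.
(* The inverse affine map is substituted, which turns the integrand back into [|f x|]. *)
rewrite (@ge0_integral_affine a^-1 (- b / a)) ?invr_eq0//=; last first.
  by do 2 apply: measurableT_comp => //.
apply: lte_mul_pinfty => //.
under eq_integral do rewrite mulrDr mulrA divff// mul1r mulrCA divff// mulr1 subrK.
exact: foo.
Qed.

Lemma Rintegral_affine a b f : a != 0 ->
  mu.-integrable setT (EFin \o f) ->
  \int[mu]_x f x = `|a| * \int[mu]_x f (a * x + b).
Proof.
move=> a0 intf; have intf' := integrable_affine b a0 intf.
pose p : R -> \bar R := ((EFin \o f)^\+)%E.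
pose q : R -> \bar R := ((EFin \o f)^\-)%E.
have mf : measurable_fun setT (EFin \o f) by case/integrableP : intf.
have fE : (\int[mu]_x (f x)%:E = \int[mu]_x p x - \int[mu]_x q x)%E.
  exact: integralE.
pose g x : \bar R := (f (a * x + b))%:E.
have gq : (\int[mu]_x q (a * x + b)%R = \int[mu]_x g^\- x)%E.
  by apply: eq_integral => x _; rewrite /q !funenegE.
have gp : (\int[mu]_x p (a * x + b)%R = \int[mu]_x g^\+ x)%E.
  by apply: eq_integral => x _; rewrite /p !funeposE.
have f'E : (\int[mu]_x g x =
    \int[mu]_x p (a * x + b)%R - \int[mu]_x q (a * x + b)%R)%E.
  by rewrite gq gp -integralE.
have qfin : (\int[mu]_x q (a * x + b)%R)%E \is a fin_num.
  by rewrite gq; exact: (integrable_neg_fin_num measurableT intf').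
have mp : measurable_fun setT p by exact (measurable_funepos mf).
have mq : measurable_fun setT q by exact (measurable_funeneg mf).
have p0 x : (0 <= p x)%E by exact: funepos_ge0.
have q0 x : (0 <= q x)%E by exact: funeneg_ge0.
rewrite /Rintegral fE (ge0_integral_affine (f := p) b a0)//.
rewrite (ge0_integral_affine (f := q) b a0)//.
rewrite -muleBr//; last by rewrite fin_num_adde_defl// fin_numN.
rewrite -f'E fineM//; exact (integrable_fin_num measurableT intf').
Qed.

End affine.

Section fubini.
Context d1 d2 (T1 : measurableType d1) (T2 : measurableType d2) (R : realType).
Variables (m1 : {sigma_finite_measure set T1 -> \bar R}).
Variables (m2 : {sigma_finite_measure set T2 -> \bar R}).
Variables (A : set T1) (B : set T2).
Hypotheses (mA : measurable A) (mB : measurable B).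

(** Extension by zero outside [A] x [B] reduces Fubini on a rectangle to Fubini on the whole
    product. *)
Let integral_patch12 (f : T1 * T2 -> \bar R) (x : T1) :
  (\int[m2]_y (f \_ (A `*` B)) (x, y) =
   ((fun x => \int[m2]_(y in B) f (x, y)) \_ A) x)%E.
Proof.
rewrite patchE; case: ifPn => xA.
  rewrite [RHS]integral_mkcond; apply: eq_integral => y _.
  by rewrite !patchE in_setX/= xA.
by under eq_integral do rewrite patchE in_setX/= (negbTE xA); rewrite integral0.
Qed.

Let integral_patch21 (f : T1 * T2 -> \bar R) (y : T2) :
  (\int[m1]_x (f \_ (A `*` B)) (x, y) =
   ((fun y => \int[m1]_(x in A) f (x, y)) \_ B) y)%E.
Proof.
rewrite patchE; case: ifPn => yB.
  rewrite [RHS]integral_mkcond; apply: eq_integral => x _.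
  by rewrite !patchE in_setX/= yB andbT.
under eq_integral do rewrite patchE in_setX/= (negbTE yB) andbF.
by rewrite integral0.
Qed.

Let measurable_patch (f : T1 * T2 -> \bar R) :
  measurable_fun setT f -> measurable_fun setT (f \_ (A `*` B)).
Proof.
move=> mf; apply/(measurable_restrict _ (measurableX mA mB) measurableT).
exact: measurable_funS mf.
Qed.

Lemma tonelli (f : T1 * T2 -> \bar R) :
  measurable_fun setT f -> (forall z, 0 <= f z)%E ->
  (\int[m1]_(x in A) \int[m2]_(y in B) f (x, y) =
   \int[m2]_(y in B) \int[m1]_(x in A) f (x, y))%E.
Proof.
move=> mf f0; rewrite [LHS]integral_mkcond [RHS]integral_mkcond.
under eq_integral do rewrite -integral_patch12.
under [RHS]eq_integral do rewrite -integral_patch21.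
rewrite fubini_tonelli//; first exact: measurable_patch.
by move=> z; rewrite patchE; case: ifPn.
Qed.

Section dominated.
Variables (f : T1 * T2 -> R) (g : T1 -> R) (h : T2 -> R).
Hypothesis mf : measurable_fun setT f.
Hypothesis intg : m1.-integrable A (EFin \o g).
Hypothesis inth : m2.-integrable B (EFin \o h).
Hypothesis f_gh : forall x y, A x -> B y -> `|f (x, y)| <= g x * h y.

(** The iterated integral of [|f|] is at most the product of the integrals of [|g|] and [|h|]. *)
Let integrable_patch :
  (m1 \x m2)%E.-integrable setT ((EFin \o f) \_ (A `*` B)).
Proof.
have mpf : measurable_fun setT ((EFin \o f) \_ (A `*` B)).
  by apply: measurable_patch; exact/measurable_EFinP.
apply/integrable12ltyP => //.
have ? := integrable_fin_num mB (integrable_abse inth).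
apply: (@le_lt_trans _ _
  (\int[m1]_x (((fun x => `|g x|%:E * \int[m2]_(y in B) `|h y|%:E) \_ A) x))%E).
  apply: ge0_le_integral => //=.
  - by move=> x _; exact: integral_ge0.
  - apply: (measurable_fun_fubini_tonelli_F
      (fun z => `|((EFin \o f) \_ (A `*` B)) z|%E)) => //.
    exact: measurableT_comp.
  - apply/(measurable_restrict _ mA measurableT); rewrite setTI.
    apply: emeasurable_funM => //; apply/measurable_EFinP/measurableT_comp => //.
    by apply/measurable_EFinP; case/integrableP : intg.
  - move=> x _; rewrite patchE; case: ifPn => xA; last first.
      under eq_integral do rewrite patchE in_setX/= (negbTE xA) abse0.
      by rewrite integral0.
    have mh : measurable_fun B (fun y => `|h y|%:E).
      case/integrableP : inth => /measurable_EFinP ? _.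
      by apply/measurable_EFinP; exact: measurableT_comp.
    rewrite -ge0_integralZl//.
    rewrite [leRHS]integral_mkcond; apply: ge0_le_integral => //=.
    + apply: measurableT_comp => //.
      exact: measurable_fun_pair2.
    + apply/(measurable_restrict _ mB measurableT); rewrite setTI.
      exact: emeasurable_funM.
    + move=> y _; rewrite !patchE in_setX/= xA/=; case: ifPn => yB /=.
        (* [g x * h y] bounds a norm, so it is nonnegative and equals [|g x| * |h y|]. *)
        rewrite -EFinM lee_fin -normrM ger0_norm; first exact/f_gh/set_mem/yB/set_mem.
        exact: le_trans (f_gh (set_mem xA) (set_mem yB)).
      by rewrite normr0; exact: lexx.
rewrite -integral_mkcond ge0_integralZr//=.
- apply: lte_mul_pinfty => //.
    by apply: integral_ge0.
    exact: (integrable_fin_num mA (integrable_abse intg)).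
  by rewrite ltey_eq; apply/orP; left.
- case/integrableP : intg => /measurable_EFinP ? _.
  by apply/measurable_EFinP; exact: measurableT_comp.
- exact: integral_ge0.
Qed.

Let integrable_section x : A x -> m2.-integrable B (fun y => (f (x, y))%:E).
Proof.
move=> Ax; apply: (le_integrable mB _ _ (integrableZl mB (g x) inth)) => /=.
  by apply/measurable_EFinP/measurable_funTS; exact: measurable_fun_pair2.
move=> y By; rewrite lee_fin (le_trans (f_gh Ax By))//.
by rewrite ler_norm.
Qed.

Let integrable_section' y : B y -> m1.-integrable A (fun x => (f (x, y))%:E).
Proof.
move=> By; apply: (le_integrable mA _ _ (integrableZl mA (h y) intg)) => /=.
  by apply/measurable_EFinP/measurable_funTS; exact: measurable_fun_pair1.
move=> x Ax; rewrite lee_fin (le_trans (f_gh Ax By))//.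
by rewrite mulrC ler_norm.
Qed.

Lemma integrable_fubini1 :
  m1.-integrable A (fun x => (\int[m2]_(y in B) f (x, y))%:E).
Proof.
have := integrable_fubini_F integrable_patch.
rewrite /fubini_F => /(eq_integrable measurableT) H.
apply/(integrable_mkcond _ mA); apply: H => x _.
rewrite integral_patch12 !patchE; case: ifPn => // /set_mem Ax.
by rewrite /Rintegral fineK//; exact: (integrable_fin_num mB (integrable_section Ax)).
Qed.

Lemma Rfubini : \int[m1]_(x in A) \int[m2]_(y in B) f (x, y) =
                \int[m2]_(y in B) \int[m1]_(x in A) f (x, y).
Proof.
congr fine; transitivity
    (\int[m1]_(x in A) \int[m2]_(y in B) (f (x, y))%:E)%E.
  apply: eq_integral => x /set_mem Ax.
  by rewrite /Rintegral fineK//; exact: (integrable_fin_num mB (integrable_section Ax)).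
transitivity (\int[m2]_(y in B) \int[m1]_(x in A) (f (x, y))%:E)%E; last first.
  apply: eq_integral => y /set_mem By.
  by rewrite /Rintegral fineK//; exact: (integrable_fin_num mA (integrable_section' By)).
rewrite [LHS]integral_mkcond [RHS]integral_mkcond.
under eq_integral do rewrite -(integral_patch12 (EFin \o f)).
under [RHS]eq_integral do rewrite -(integral_patch21 (EFin \o f)).
exact: (Fubini integrable_patch).
Qed.

End dominated.
End fubini.

(** Almost everywhere convergence is what the equidistribution argument can offer: there the
    endpoints 0 and 1 are excluded. *)
Lemma Rdominated_cvg d (T : measurableType d) (R : realType)
    (mu : {measure set T -> \bar R}) (D : set T) (f_ : nat -> T -> R)
    (f g : T -> R) :
  measurable D -> (forall n, measurable_fun D (f_ n)) -> measurable_fun D f ->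
  {ae mu, forall x, D x -> f_ n x @[n --> \oo] --> f x} ->
  mu.-integrable D (EFin \o g) ->
  (forall n x, D x -> `|f_ n x| <= g x) ->
  \int[mu]_(x in D) f_ n x @[n --> \oo] --> \int[mu]_(x in D) f x.
Proof.
move=> mD mf_ mf f_f intg f_g.
have mf_' n : measurable_fun D (EFin \o f_ n) by exact/measurable_EFinP.
have mf' : measurable_fun D (EFin \o f) by exact/measurable_EFinP.
have f_f' : {ae mu, forall x, D x -> (EFin \o f_ n) x @[n --> \oo] --> (EFin \o f) x}.
  by apply: filterS f_f => x H Dx; apply: cvg_EFin; [exact: nearW|exact: H].
have f_g' : {ae mu, forall x n, D x -> (`|(EFin \o f_ n) x| <= (EFin \o g) x)%E}.
  by apply: aeW => x n Dx; rewrite lee_fin f_g.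
have [intf _ cvgf] := dominated_convergence mD mf_' mf' f_f' intg f_g'.
by apply: fine_cvg; rewrite fineK//; exact: (integrable_fin_num mD intf).
Qed.

(** * Continuity and primitives on the real line *)

Section continuity.
Context {R : realType}.
Implicit Types f g : R -> R.

Lemma contD f g : continuous f -> continuous g -> continuous (fun x => f x + g x).
Proof. by move=> cf cg x; apply: cvgD; [exact: cf|exact: cg]. Qed.

Lemma contN f : continuous f -> continuous (fun x => - f x).
Proof. by move=> cf x; apply: cvgN; exact: cf. Qed.

Lemma contM f g : continuous f -> continuous g -> continuous (fun x => f x * g x).
Proof. by move=> cf cg x; apply: cvgM; [exact: cf|exact: cg]. Qed.

Lemma contX f n : continuous f -> continuous (fun x => f x ^+ n).
Proof.
move=> cf x; apply: (@continuous_comp _ _ _ f (fun y => y ^+ n)); first exact: cf.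
exact: exprn_continuous.
Qed.

Lemma cont_expR f : continuous f -> continuous (fun x => expR (f x)).
Proof.
by move=> cf x; apply: (@continuous_comp _ _ _ f expR); [exact: cf|exact: continuous_expR].
Qed.

Lemma cont_cos f : continuous f -> continuous (fun x => cos (f x)).
Proof.
by move=> cf x; apply: (@continuous_comp _ _ _ f cos); [exact: cf|exact: continuous_cos].
Qed.

Lemma cont_sin f : continuous f -> continuous (fun x => sin (f x)).
Proof.
by move=> cf x; apply: (@continuous_comp _ _ _ f sin); [exact: cf|exact: continuous_sin].
Qed.

Lemma cont_sqrt f : continuous f -> continuous (fun x => Num.sqrt (f x)).
Proof.
by move=> cf x; apply: (@continuous_comp _ _ _ f Num.sqrt); [exact: cf|exact: sqrt_continuous].
Qed.

Lemma cont_norm f : continuous f -> continuous (fun x => `|f x|).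
Proof.
by move=> cf x; apply: (@continuous_comp _ _ _ f Num.norm); [exact: cf|exact: norm_continuous].
Qed.

Lemma cont_cst (c : R) : continuous (fun _ : R => c).
Proof. by move=> x; exact: cvg_cst. Qed.

Lemma cont_id : continuous (fun x : R => x).
Proof. by move=> x; exact: cvg_id. Qed.

End continuity.

Ltac cont_step := lazymatch goal with
  | |- forall x, continuous_at x (fun y => (@?f y + @?g y)%R) => apply: (@contD _ f g)
  | |- forall x, continuous_at x (fun y => (@?f y * @?g y)%R) => apply: (@contM _ f g)
  | |- forall x, continuous_at x (fun y => (@?f y ^+ ?n)%R) => apply: (@contX _ f n)
  | |- forall x, continuous_at x (fun y => (- @?f y)%R) => apply: (@contN _ f)
  | |- forall x, continuous_at x (fun y => expR (@?f y)) => apply: (@cont_expR _ f)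
  | |- forall x, continuous_at x (fun y => cos (@?f y)) => apply: (@cont_cos _ f)
  | |- forall x, continuous_at x (fun y => sin (@?f y)) => apply: (@cont_sin _ f)
  | |- forall x, continuous_at x (fun y => Num.sqrt (@?f y)) => apply: (@cont_sqrt _ f)
  | |- forall x, continuous_at x (fun y => `|@?f y|%R) => apply: (@cont_norm _ f)
  | |- forall x, continuous_at x (fun y => y) => exact: cont_id
  | |- forall x, continuous_at x (fun y => _) => exact: cont_cst
  end.
Ltac cont := repeat first [ assumption | cont_step ].

Section calculus.
Context {R : realType}.
Local Notation mu := (@lebesgue_measure R).
Implicit Types f g P : R -> R.

Lemma continuous_comp1 f g : continuous f -> continuous g -> continuous (fun x => g (f x)).
Proof. by move=> cf cg x; apply: continuous_comp; [exact: cf|exact: cg]. Qed.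

Lemma is_derive1M f g (x df dg : R) : is_derive x 1 f df -> is_derive x 1 g dg ->
  is_derive x 1 (fun y => f y * g y) (df * g x + f x * dg).
Proof.
move=> hf hg; have := is_deriveM hf hg.
by move=> h; apply: is_derive_eq h _; rewrite /GRing.scale/= addrC (mulrC df).
Qed.

Lemma is_derive1D f g (x df dg : R) : is_derive x 1 f df -> is_derive x 1 g dg ->
  is_derive x 1 (fun y => f y + g y) (df + dg).
Proof. exact: is_deriveD. Qed.

Lemma is_derive1B f g (x df dg : R) : is_derive x 1 f df -> is_derive x 1 g dg ->
  is_derive x 1 (fun y => f y - g y) (df - dg).
Proof. exact: is_deriveB. Qed.

Lemma is_derive1_affine (a b x : R) : is_derive x 1 (fun y => a * y + b) a.
Proof.
apply: is_derive_eq.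
by rewrite /GRing.scale/= ?(mulr0, addr0, mulr1).
Qed.

Lemma is_derive1_cst_eq P : (forall x : R, is_derive x 1 P 0) -> forall x y : R, P x = P y.
Proof. by move=> dP x y; exact: is_derive_0_is_cst. Qed.

Lemma is_derive1_continuous P f : (forall x : R, is_derive x 1 P (f x)) -> continuous P.
Proof.
move=> dP x; apply/differentiable_continuous/derivable1_diffP.
by case: (dP x).
Qed.

Lemma continuous_locally_integrable f (a b : R) : continuous f ->
  mu.-integrable `[a, b] (EFin \o f).
Proof.
move=> cf; apply: continuous_compact_integrable; first exact: segment_compact.
exact: continuous_subspaceT.
Qed.

(** An integral from a fixed left endpoint is a primitive only to the right of it. Normalising [F c]
    to vanish at 0 makes it independent of the endpoint [c], so an endpoint varying with [x] glues
    these local primitives together. *)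
Lemma continuous_primitive f : continuous f ->
  exists P, forall x : R, is_derive x 1 P (f x).
Proof.
move=> cf.
have intf a b := continuous_locally_integrable a b cf.
pose F c x := \int[mu]_(t in `[c, x]) f t - \int[mu]_(t in `[c, 0]) f t.
have split_int c c' x : c <= c' -> c' <= x ->
    \int[mu]_(t in `[c, x]) f t =
    \int[mu]_(t in `[c, c']) f t + \int[mu]_(t in `[c', x]) f t.
  move=> cc' c'x.
  have := @Rintegral_itvB R f (BLeft c) (BRight x) c' (intf _ _).
  rewrite !bnd_simp => /(_ cc' c'x) /eqP; rewrite subr_eq => /eqP ->.
  rewrite Rintegral_itv_obnd_cbnd 1?addrC//.
  by apply: integrableS (intf c' x) => //; exact: subset_itv_oc_cc.
have FE c c' x : c <= c' -> c' <= x -> c' <= 0 -> F c x = F c' x.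
  move=> cc' c'x c'0; rewrite /F (split_int c c' x)// (split_int c c' 0)//.
  by rewrite opprD addrACA subrr add0r.
exists (fun x => F (- `|x| - 1) x) => x0.
(* For [x] within 1 of [x0] the endpoint [- |x| - 1] is at least this [c]. *)
pose c := - `|x0| - 2.
have cx0 : c < x0.
  by rewrite /c; have := ler_norm (- x0); rewrite normrN; lra.
have x0x1 : x0 < x0 + 1 by lra.
have cBx0 : (BLeft c < BRight x0)%E by rewrite /= lte_fin.
have [dF F'E] := continuous_FTC1 x0x1 (intf c (x0 + 1)) cBx0 (cf x0).
apply: (@near_eq_is_derive _ _ _ (F c)).
  near=> x; apply: FE.
  - rewrite /c; suff : `|x| <= `|x0| + 1 by lra.
    have : `|x0 - x| <= 1 by near: x; apply: cvgr_dist_le => //; exact: cvg_id.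
    by have := ler_normB x0 (x0 - x); rewrite opprB addrC subrK; lra.
  - by have := ler_norm (- x); rewrite normrN; lra.
  - by have := normr_ge0 x; lra.
apply: is_derive_eq; first apply: is_deriveB.
  apply: DeriveDef; first exact: dF.
  by rewrite -derive1E F'E.
by rewrite subr0.
Unshelve. all: end_near. Qed.

Lemma Rintegral_FTC f P (a b : R) : continuous f ->
  (forall x : R, is_derive x 1 P (f x)) -> a <= b ->
  \int[mu]_(x in `[a, b]) f x = P b - P a.
Proof.
move=> cf dP; rewrite le_eqVlt => /predU1P[->|ab].
  by rewrite set_itv1 Rintegral_set1 subrr.
have cP := is_derive1_continuous dP.
rewrite /Rintegral (@continuous_FTC2 R f P a b ab) //.
- exact: continuous_subspaceT.
- split.
  + by move=> x _; case: (dP x).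
  + exact/cvg_at_right_filter/cP.
  + exact/cvg_at_left_filter/cP.
- by move=> x _; rewrite derive1E; case: (dP x).
Qed.

(** For a primitive [P], periodicity makes P(x + (b - a)) - P(x) constant; its values at [a + c] and
    at [a] are the two integrals. *)
Lemma Rintegral_periodic f (a b c : R) : continuous f -> a <= b ->
  (forall x, f (x + (b - a)) = f x) ->
  \int[mu]_(x in `[a, b]) f (1 * x + c) = \int[mu]_(x in `[a, b]) f x.
Proof.
move=> cf ab fp; have [P dP] := continuous_primitive cf.
have dPs (d x : R) : is_derive x 1 (fun x => P (1 * x + d)) (f (1 * x + d)).
  have h := is_derive1_comp (g := fun x => 1 * x + d) (dP (1 * x + d)) (is_derive1_affine 1 d x).
  by apply: is_derive_eq h _; rewrite mulr1.
have cs d : continuous (fun x : R => f (1 * x + d)).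
  by apply: (@continuous_comp1 (fun x => 1 * x + d)) => //; cont.
rewrite (Rintegral_FTC cf dP ab) (Rintegral_FTC (cs c) (dPs c) ab).
have /is_derive1_cst_eq D0 : forall x : R, is_derive x 1 (fun x => P (1 * x + (b - a)) - P x) 0.
  move=> x; have h := is_derive1B (dPs (b - a) x) (dP x).
  by apply: (is_derive_eq h); rewrite mul1r fp subrr.
have := D0 (a + c) a; rewrite !mul1r.
have -> : a + c + (b - a) = b + c by ring.
by have -> : a + (b - a) = b by ring.
Qed.

Lemma continuous_inv1Dsqr : continuous (fun x : R => (1 + x ^+ 2)^-1).
Proof.
move=> x; apply: cvgV; last first.
  by apply: (_ : continuous (fun x : R => 1 + x ^+ 2)); cont.
by rewrite gt_eqF// ltr_pwDl// sqr_ge0.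
Qed.

(* The substitution [s = pi / 2 + atan x] on a quarter of the circle. *)
Lemma integral_circle_atan g : continuous g -> (forall x, 0 <= g x) ->
  (\int[mu]_(x in `]0%R, +oo[) (g (1 + x ^+ 2)^-1 * (1 + x ^+ 2)^-1)%:E =
   (4^-1 * \int[mu]_(s in `[- pi, pi]) g (sin s ^+ 2))%:E)%E.
Proof.
move=> cg g0; pose G s := g (sin s ^+ 2).
have cG : continuous G.
  by apply: (@continuous_comp1 (fun s => sin s ^+ 2)) => //; cont.
have [P dP] := continuous_primitive cG.
have Gpi s : G (s + pi) = G s by rewrite /G sinDpi sqrrN.
have pi0 := pi_gt0 R.
rewrite (Rintegral_FTC cG dP); last by lra.
pose F x := P (pi / 2 + atan x).
have dF (x : R) : is_derive x 1 F (g (1 + x ^+ 2)^-1 * (1 + x ^+ 2)^-1).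
  have h : is_derive x 1 (fun x => pi / 2 + atan x) (1 + x ^+ 2)^-1.
    by have := is_derive1D (is_derive_cst (pi / 2) x 1) (is_derive1_atan x); rewrite add0r.
  apply: is_derive_eq (is_derive1_comp (g := fun x => pi / 2 + atan x) (dP _) h) _.
  by rewrite /G addrC sinDpihalf cos_atan exprVn sqr_sqrtr// addr_ge0// sqr_ge0.
have cint : continuous (fun x : R => g (1 + x ^+ 2)^-1 * (1 + x ^+ 2)^-1).
  apply: contM; last exact: continuous_inv1Dsqr.
  by apply: (@continuous_comp1 (fun x => (1 + x ^+ 2)^-1)) => //; exact: continuous_inv1Dsqr.
have cF := is_derive1_continuous dF.
rewrite integral_itv_obnd_cbnd; last first.
  by apply/measurable_EFinP/measurable_funTS; exact: continuous_measurable_fun.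
rewrite (@ge0_continuous_FTC2y _ _ F _ (P pi)).
- rewrite /F atan0 addr0 -EFinB; congr EFin.
  (* The substitution covers [pi/2, pi] only. Periodicity ([D0]) equates the two half circles, and
     the reflection s -> pi - s ([E0]) the two halves of [0, pi], whence the factor 1/4. *)
  have /is_derive1_cst_eq D0 : forall x : R, is_derive x 1 (fun x => P (1 * x + pi) - P x) 0.
    move=> x; have h := is_derive1_comp (g := fun x => 1 * x + pi) (dP _)
      (is_derive1_affine 1 pi x).
    apply: (is_derive_eq (is_derive1B h (dP x))).
    by rewrite mul1r Gpi mulr1 subrr.
  have /is_derive1_cst_eq E0 : forall x : R, is_derive x 1 (fun x => P ((-1) * x + pi) + P x) 0.
    move=> x; have h := is_derive1_comp (g := fun x => (-1) * x + pi) (dP _)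
      (is_derive1_affine (-1) pi x).
    apply: (is_derive_eq (is_derive1D h (dP x))).
    by rewrite Gpi /G mulN1r sinN sqrrN; ring.
  have := D0 0 (- pi); have := E0 0 (pi / 2).
  rewrite !mul1r addNr mulN1r oppr0 add0r.
  by rewrite (_ : -1 * (pi / 2) + pi = pi / 2); [lra|field].
- by move=> x _; rewrite mulr_ge0// invr_ge0 addr_ge0// sqr_ge0.
- exact: continuous_subspaceT.
- rewrite [X in _ --> P X](_ : pi = pi / 2 + pi / 2); last by field.
  apply: continuous_cvg; first exact: (is_derive1_continuous dP).
  by apply: cvgD; [exact: cvg_cst|exact: cvgy_atan].
- by move=> x _; case: (dF x).
- exact/cvg_at_right_filter/cF.
- by move=> x _; rewrite derive1E; case: (dF x).
Qed.

End calculus.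

(** * The Gaussian and its Fourier transform *)

Section bell.
Context {R : realType}.
Local Notation mu := (@lebesgue_measure R).
Implicit Types (b c r x y : R).

(** Unnormalised centred Gaussian of variance 1/b: products add the parameters, and Fourier and
    Hankel transforms exchange [b] and [b^-1]. *)
Definition bell b y := expR (- (b * y ^+ 2 / 2)).

Lemma bell_gt0 b y : 0 < bell b y. Proof. exact: expR_gt0. Qed.

Lemma bell_ge0 b y : 0 <= bell b y. Proof. exact: expR_ge0. Qed.

Lemma bell_le1 b y : 0 <= b -> bell b y <= 1.
Proof.
move=> b0; rewrite -expR0 ler_expR oppr_le0 divr_ge0// mulr_ge0//.
exact: sqr_ge0.
Qed.

Lemma bellD a b y : bell (a + b) y = bell a y * bell b y.
Proof. by rewrite /bell -expRD; congr expR; ring. Qed.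

Lemma bell0 y : bell 0 y = 1.
Proof. by rewrite /bell !mul0r oppr0 expR0. Qed.

Lemma bell_at0 b : bell b 0 = 1.
Proof. by rewrite /bell expr0n/= mulr0 mul0r oppr0 expR0. Qed.

Lemma bellN b y : bell b (- y) = bell b y.
Proof. by rewrite /bell sqrrN. Qed.

Lemma continuous_bell b : continuous (bell b).
Proof. by rewrite /bell; cont. Qed.

End bell.

Ltac contb := repeat first [ assumption | exact: continuous_bell | cont_step ].

Section gaussian.
Context {R : realType}.
Local Notation mu := (@lebesgue_measure R).
Implicit Types (b c r x y : R).

Lemma measurable_bell b : measurable_fun setT (bell b).
Proof. by apply: continuous_measurable_fun; exact: continuous_bell. Qed.

Lemma integral_bell b : 0 < b ->
  (\int[mu]_y (bell b y)%:E = (Num.sqrt (2 * pi / b))%:E)%E.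
Proof.
move=> b0; have s0 : 0 < Num.sqrt (b / 2) by rewrite sqrtr_gt0 divr_gt0.
have mg : measurable_fun setT (EFin \o @gauss_fun R).
  by apply/measurable_EFinP; exact: measurable_gauss_fun.
have := ge0_integral_affine 0 (lt0r_neq0 s0) mg
  (fun x => (gauss_fun_ge0 x : 0 <= (gauss_fun x)%:E)%E).
rewrite integralT_gauss => /esym.
have -> : (\int[mu]_x (EFin \o @gauss_fun R) (Num.sqrt (b / 2) * x + 0)%R =
    \int[mu]_y (bell b y)%:E)%E.
  apply: eq_integral => x _; rewrite /= addr0 /gauss_fun /bell exprMn sqr_sqrtr.
    by congr (expR _)%:E; ring.
  by rewrite divr_ge0// ltW.
rewrite gtr0_norm// => h.
have -> : (\int[mu]_y (bell b y)%:E = (Num.sqrt (b / 2))^-1%:E *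
    ((Num.sqrt (b / 2))%:E * \int[mu]_y (bell b y)%:E))%E.
  by rewrite muleA -EFinM mulVf ?mul1e// gt_eqF.
rewrite h -EFinM; congr EFin.
have -> : 2 * pi / b = (b / 2)^-1 * pi by field; rewrite gt_eqF.
have b2 : 0 <= b / 2 by rewrite divr_ge0// ltW.
by rewrite (sqrtrM pi) ?invr_ge0// sqrtrV.
Qed.

Lemma integrable_bell b : 0 < b -> mu.-integrable setT (EFin \o bell b).
Proof.
move=> b0; apply/integrableP; split.
  by apply/measurable_EFinP; exact: measurable_bell.
under eq_integral do rewrite /= ger0_norm ?bell_ge0//.
by rewrite integral_bell// ltry.
Qed.

(** Half of the exponent absorbs the factor: |y| <= 1/2 + y^2/2 <= (1/2 + 2/b)(1 + b y^2/4), and 1 +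
    z <= exp z. *)
Lemma norm_mul_bell_le b y : 0 < b ->
  `|y| * bell b y <= (2^-1 + 2 / b) * bell (b / 2) y.
Proof.
move=> b0; have -> : bell b y = bell (b / 2) y * bell (b / 2) y.
  by rewrite -bellD -[in LHS](_ : b / 2 + b / 2 = b)//; field.
rewrite mulrA; apply: ler_wpM2r; first exact: bell_ge0.
rewrite /bell expRN ler_pdivrMr ?expR_gt0//.
have e1 := expR_ge1Dx (b / 2 * y ^+ 2 / 2).
have y20 := sqr_ge0 y.
have ib0 : 0 < b^-1 by rewrite invr_gt0.
have : `|y| <= 2^-1 + y ^+ 2 / 2.
  rewrite -[y ^+ 2]real_normK ?num_real//; have := sqr_ge0 (`|y| - 1); nra.
move=> /le_trans; apply.
apply: (@le_trans _ _ ((2^-1 + 2 / b) * (1 + b / 2 * y ^+ 2 / 2))).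
  have -> : (2^-1 + 2 / b) * (1 + b / 2 * y ^+ 2 / 2) =
    2^-1 + y ^+ 2 / 2 + (2 / b + b / 8 * y ^+ 2) by field; rewrite gt_eqF.
  by rewrite lerDl; nra.
apply: ler_wpM2l => //; nra.
Qed.

Lemma integrable_mul_bell b : 0 < b ->
  mu.-integrable setT (fun y => (`|y| * bell b y)%:E).
Proof.
move=> b0.
have ib : mu.-integrable setT (fun y => (2^-1 + 2 / b)%:E * (bell (b / 2) y)%:E)%E.
  by apply: integrableZl => //; apply: integrable_bell; rewrite divr_gt0.
apply: (le_integrable _ _ _ ib) => //.
  apply/measurable_EFinP/measurable_funM; last exact: measurable_bell.
  by apply: continuous_measurable_fun; exact: norm_continuous.
move=> y _; rewrite -EFinM !abse_EFin lee_fin ger0_norm; last by rewrite mulr_ge0// bell_ge0.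
by rewrite (le_trans (norm_mul_bell_le y b0))// ler_norm.
Qed.

Lemma is_derive1_bell b (y : R) : is_derive y 1 (bell b) (- (b * y) * bell b y).
Proof.
have h : is_derive y 1 (fun y : R => - (b * y ^+ 2 / 2)) (- (b * y)).
  by apply: is_derive_eq; rewrite /GRing.scale/=; field.
have := is_derive1_comp (g := fun y => - (b * y ^+ 2 / 2)) (is_derive_expR _) h.
by rewrite [X in is_derive _ _ _ X]mulrC.
Qed.

Lemma cvg_bell_pinfty b : 0 < b -> bell b t @[t --> +oo] --> 0.
Proof.
move=> b0; have s0 : 0 < Num.sqrt (b / 2) by rewrite sqrtr_gt0 divr_gt0.
rewrite (_ : bell b = (fun t => gauss_fun (Num.sqrt (b / 2) * t))).
  apply: (cvg_comp (fun t => Num.sqrt (b / 2) * t) (@gauss_fun R)); last exact: cvg_gauss_fun.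
  by apply: gt0_cvgMry => //; exact: cvg_id.
apply/funext => t; rewrite /bell /gauss_fun exprMn sqr_sqrtr ?divr_ge0 ?(ltW b0)//.
by congr (expR (- _)); rewrite mulrAC.
Qed.

Lemma cvg_bell b : 0 < b -> bell b n%:R @[n --> \oo] --> 0.
Proof.
by move=> b0; exact: (cvg_comp (fun n : nat => n%:R) (bell b) cvgr_idn (cvg_bell_pinfty b0)).
Qed.

(** The truncations to [-n, n] are evaluated by the fundamental theorem and tend to the full
    integral by domination, so limits along the integers suffice. *)
Lemma Rintegral_derive0 (f P : R -> R) : continuous f ->
  (forall x : R, is_derive x 1 P (f x)) -> mu.-integrable setT (EFin \o f) ->
  P n%:R @[n --> \oo] --> 0 -> P (- n%:R) @[n --> \oo] --> 0 ->
  \int[mu]_x f x = 0.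
Proof.
move=> cf dP intf Py PNy.
have mf : measurable_fun setT f by exact: continuous_measurable_fun.
have h n : \int[mu]_x (f \_ `[- n%:R, n%:R]) x = P n%:R - P (- n%:R).
  by rewrite -Rintegral_mkcond (Rintegral_FTC cf dP)// lerNl (@le_trans _ _ 0)// oppr_le0.
have h0 : P n%:R - P (- n%:R) @[n --> \oo] --> 0.
  by rewrite -[X in _ --> X](subrr 0); apply: cvgB.
suff h1 : \int[mu]_x (f \_ `[- n%:R, n%:R]) x @[n --> \oo] --> \int[mu]_x f x.
  rewrite (funext h) in h1.
  by rewrite -(cvg_lim (@Rhausdorff R) h1) (cvg_lim (@Rhausdorff R) h0).
apply: (@Rdominated_cvg _ _ R mu setT (fun n => f \_ `[- n%:R, n%:R]) f
  (fun x => `|f x|)) => //.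
- move=> n; apply/(measurable_restrictT _ _).1 => //; exact: measurable_funTS.
- apply: aeW => x _; apply: cvg_near_cst; near=> n.
  rewrite patchE mem_set//= in_itv/= -ler_norml.
  near: n; exact: nbhs_infty_ger.
- exact: (integrable_abse intf).
- by move=> n x _; rewrite patchE; case: ifPn => // _; rewrite normr0.
Unshelve. all: end_near. Qed.


Lemma integrable_bell_mul b (h : R -> R) : 0 < b -> continuous h ->
  (forall y, `|h y| <= 1) -> mu.-integrable setT (fun y => (bell b y * h y)%:E).
Proof.
move=> b0 ch h1; apply: (le_integrable _ _ _ (integrable_bell b0)) => //.
  apply/measurable_EFinP; apply: continuous_measurable_fun.
  by apply: contM => //; exact: continuous_bell.
move=> y _; rewrite lee_fin normrM ger0_norm ?bell_ge0//.
by rewrite ler_piMr// bell_ge0.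
Qed.

(** The left side F solves F'(x) = -(x/b) F(x), by differentiation under the integral and
    integration by parts; F(0) is the Gaussian mass. *)
Lemma bell_fourier b x : 0 < b ->
  \int[mu]_y (bell b y * cos (x * y)) = Num.sqrt (2 * pi / b) * bell b^-1 x.
Proof.
move=> b0; pose F x := \int[mu]_y (bell b y * cos (x * y)).
have cos1 (z : R) : `|cos z| <= 1 by rewrite ler_norml cos_geN1 cos_le1.
have sin1 (z : R) : `|sin z| <= 1 by rewrite ler_norml sin_geN1 sin_le1.
have icos z : mu.-integrable setT (fun y => (bell b y * cos (z * y))%:E).
  by apply: integrable_bell_mul => //; cont.
have iysin z : mu.-integrable setT (fun y => (y * bell b y * sin (z * y))%:E).
  apply: (le_integrable _ _ _ (integrable_mul_bell b0)) => //.
    apply/measurable_EFinP; apply: continuous_measurable_fun; contb.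
  by move=> y _; rewrite lee_fin !normrM normr_id ler_piMr.
have dcos (z y : R) : is_derive z 1 (fun z => bell b y * cos (z * y))
    (- (y * bell b y * sin (z * y))).
  have h1 := is_derive1_comp (g := fun z => y * z + 0) (is_derive_cos (y * z + 0)) (is_derive1_affine y 0 z).
  have h2 := is_derive1M (is_derive_cst (bell b y) z 1) h1.
  have -> : (fun z => bell b y * cos (z * y)) =
      (fun z => bell b y * cos (y * z + 0)).
    by apply/funext => t; rewrite addr0 (mulrC y).
  by apply: (is_derive_eq h2); rewrite /= addr0 (mulrC z y); ring.
have dF (z : R) : is_derive z 1 F (\int[mu]_y (- (y * bell b y * sin (z * y)))).
  have zI : `]z - 1, z + 1[%classic z by rewrite /= in_itv/=; lra.
  have d1 (u y : R) : derivable (fun z : R => bell b y * cos (z * y)) u 1 by case: (dcos u y).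
  have E1 (u y : R) : partial1of2 (fun z y : R => bell b y * cos (z * y)) u y =
      - (y * bell b y * sin (u * y)).
    by rewrite partial1of2E; case: (dcos u y).
  have bnd (u y : R) : `|partial1of2 (fun z y : R => bell b y * cos (z * y)) u y| <= `|y| * bell b y.
    by rewrite E1 normrN !normrM (ger0_norm (bell_ge0 b y)) ler_piMr// mulr_ge0// bell_ge0.
  have G0 y : 0 <= `|y| * bell b y by rewrite mulr_ge0// bell_ge0.
  apply: DeriveDef.
    exact: (derivable_under_integral measurableT zI (fun u _ => icos u)
      (fun u y _ _ => d1 u y) G0 (integrable_mul_bell b0) (fun u y _ _ => bnd u y)).
  rewrite -derive1E (differentiation_under_integral measurableT zI (fun u _ => icos u)
      (fun u y _ _ => d1 u y) G0 (integrable_mul_bell b0) (fun u y _ _ => bnd u y)).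
  by apply: eq_Rintegral => y _; rewrite E1.
(* The y-derivative of [bell b y * sin (z * y)] has integral 0, which trades the sine integral for
   [z / b] times the cosine integral. *)
have ibp z : \int[mu]_y (- (y * bell b y * sin (z * y))) = - (z / b) * F z.
  pose Q y := bell b y * sin (z * y).
  have dQ (y : R) : is_derive y 1 Q
      (- b * (y * bell b y * sin (z * y)) + z * (bell b y * cos (z * y))).
    have h1 := is_derive1_comp (g := fun y => z * y + 0) (is_derive_sin _) (is_derive1_affine z 0 y).
    have h2 := is_derive1M (is_derive1_bell b y) h1.
    have -> : Q = (fun y => bell b y * sin (z * y + 0)).
      by apply/funext => t; rewrite addr0.
    by apply: (is_derive_eq h2); rewrite /= addr0; ring.
  have Qlim s : (forall n, `|s n| = n%:R) -> Q (s n) @[n --> \oo] --> 0.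
    move=> sn; apply/norm_cvg0P.
    apply: (@squeeze_cvgr _ _ _ _ (cst 0) (fun n => bell b n%:R)).
    - near=> n; rewrite normr_ge0/= /Q normrM (ger0_norm (bell_ge0 _ _)).
      have -> : bell b (s n) = bell b n%:R.
        by rewrite -(sn n) /bell real_normK ?num_real.
      by rewrite ler_piMr// bell_ge0.
    - exact: cvg_cst.
    - exact: cvg_bell.
  have i1 : mu.-integrable setT (EFin \o (fun y => - b * (y * bell b y * sin (z * y)))).
    by apply: (integrableZl measurableT (- b) (iysin z)).
  have i2 : mu.-integrable setT (EFin \o (fun y => z * (bell b y * cos (z * y)))).
    by apply: (integrableZl measurableT z (icos z)).
  have cQ' : continuous (fun y => - b * (y * bell b y * sin (z * y)) +
      z * (bell b y * cos (z * y))) by contb.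
  have normn (n : nat) : `|n%:R| = n%:R :> R by rewrite ger0_norm.
  have normNn (n : nat) : `|- n%:R| = n%:R :> R by rewrite normrN normn.
  have h : - b * (\int[mu]_y (y * bell b y * sin (z * y))) + z * F z = 0.
    rewrite -[RHS](Rintegral_derive0 cQ' dQ (integrableD measurableT i1 i2)
      (Qlim _ normn) (Qlim _ normNn)) (RintegralD measurableT i1 i2).
    congr (_ + _); first exact/esym/(RintegralZl (- b) measurableT (iysin z)).
    exact/esym/(RintegralZl z measurableT (icos z)).
  under eq_Rintegral do rewrite -mulN1r.
  rewrite (RintegralZl (-1) measurableT (iysin z)) mulN1r.
  apply: (mulfI (lt0r_neq0 b0)).
  have -> : b * (- (z / b) * F z) = - (z * F z) by field; rewrite gt_eqF.
  lra.
(* Integrating factor: [bell (- b^-1) z] is exp(z^2/(2b)), so [F] times it is constant. *)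
have dD (z : R) : is_derive z 1 (fun z => F z * bell (- b^-1) z) 0.
  apply: (is_derive_eq (is_derive1M (dF z) (is_derive1_bell (- b^-1) z))).
  by rewrite ibp; ring.
have := is_derive1_cst_eq dD x 0.
rewrite {2}/bell expr0n/= mulr0 mul0r oppr0 expR0 mulr1 => h.
have F0 : F 0 = Num.sqrt (2 * pi / b).
  rewrite /F; under eq_Rintegral do rewrite mul0r cos0 mulr1.
  by rewrite /Rintegral integral_bell.
by rewrite -F0 -h -mulrA -bellD addNr bell0 mulr1.
Unshelve. all: end_near. Qed.

End gaussian.

(** * Weber's integral of the Bessel function *)

Section measurability.
Context d (T : measurableType d) (R : realType).
Implicit Types f g : T -> R.

Lemma measurable_cont_comp (h : R -> R) f : continuous h ->
  measurable_fun setT f -> measurable_fun setT (fun z => h (f z)).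
Proof. by move=> /continuous_measurable_fun mh mf; exact: measurableT_comp mh mf. Qed.

End measurability.

Ltac meas_step := lazymatch goal with
  | |- measurable_fun _ (fun z => (@?f z + @?g z)%R) => apply: (@measurable_funD _ _ _ _ f g)
  | |- measurable_fun _ (fun z => (@?f z * @?g z)%R) => apply: (@measurable_funM _ _ _ _ f g)
  | |- measurable_fun _ (fun z => (@?f z ^+ ?n)%R) =>
      apply: (@measurable_cont_comp _ _ _ (fun y => y ^+ n) f); [exact: exprn_continuous|]
  | |- measurable_fun _ (fun z => (- @?f z)%R) =>
      apply: (@measurable_cont_comp _ _ _ (fun y => - y) f); [by cont|]
  | |- measurable_fun _ (fun z => expR (@?f z)) =>
      apply: (@measurable_cont_comp _ _ _ expR f); [exact: continuous_expR|]
  | |- measurable_fun _ (fun z => cos (@?f z)) =>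
      apply: (@measurable_cont_comp _ _ _ cos f); [exact: continuous_cos|]
  | |- measurable_fun _ (fun z => sin (@?f z)) =>
      apply: (@measurable_cont_comp _ _ _ sin f); [exact: continuous_sin|]
  | |- measurable_fun _ (fun z => Num.sqrt (@?f z)) =>
      apply: (@measurable_cont_comp _ _ _ Num.sqrt f); [exact: sqrt_continuous|]
  | |- measurable_fun _ (fun z => `|@?f z|%R) =>
      apply: (@measurable_cont_comp _ _ _ Num.norm f); [exact: norm_continuous|]
  | |- measurable_fun _ (fun z => ((1 + @?f z ^+ 2)^-1)%R) =>
      apply: (@measurable_cont_comp _ _ _ (fun x => (1 + x ^+ 2)^-1) f); [exact: continuous_inv1Dsqr|]
  | |- measurable_fun _ (fun z => z.1) => exact: measurable_fst
  | |- measurable_fun _ (fun z => z.2) => exact: measurable_snd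
  | |- measurable_fun _ (fun z => z) => exact: measurable_id
  | |- measurable_fun _ (fun z => ?c) => exact: measurable_cst
  end.
Ltac meas := repeat first [ assumption | meas_step ].

Section weber.
Context {R : realType}.
Local Notation mu := (@lebesgue_measure R).
Implicit Types (b r u x y z : R).

Lemma ge0_integral_scale (a : R) (f : R -> \bar R) : 0 < a ->
  measurable_fun setT f -> (forall x, 0 <= f x)%E ->
  (\int[mu]_(x in `]0%R, +oo[) f x =
   a%:E * \int[mu]_(x in `]0%R, +oo[) f (a * x)%R)%E.
Proof.
move=> a0 mf f0; rewrite integral_mkcond.
rewrite (ge0_integral_affine 0 (lt0r_neq0 a0)).
- rewrite gtr0_norm//; congr (_ * _)%E; rewrite [RHS]integral_mkcond.
  apply: eq_integral => x _; rewrite addr0 !patchE.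
  by rewrite !mem_setE/= !in_itv/= !andbT pmulr_rgt0.
- by apply/(measurable_restrictT _ _).1 => //; exact: measurable_funTS.
- by move=> x; rewrite patchE; case: ifPn.
Qed.

Lemma integral_half_even (f : R -> R) : continuous f -> (forall x, 0 <= f x) ->
  (forall x, f (- x) = f x) ->
  (\int[mu]_x (f x)%:E = 2%:E * \int[mu]_(x in `]0%R, +oo[) (f x)%:E)%E.
Proof.
move=> cf f0 fN; rewrite ge0_symfun_integralT//; last by move=> x /=; rewrite fN.
rewrite -set_itvcy integral_itv_obnd_cbnd//.
by apply/measurable_EFinP/measurable_funTS; exact: continuous_measurable_fun.
Qed.

Lemma integral_bell_half b : 0 < b ->
  (\int[mu]_(y in `]0%R, +oo[) (bell b y)%:E = (2^-1 * Num.sqrt (2 * pi / b))%:E)%E.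
Proof.
move=> b0; have := integral_half_even (@continuous_bell _ b) (bell_ge0 b) (bellN b).
rewrite integral_bell// => h.
rewrite EFinM h muleA -EFinM mulVf ?mul1e//.
Qed.

(** Adding 1 to the cosine keeps the integrand nonnegative, so that [weber1] can rely on Tonelli
    alone. *)
Lemma integral_bell_1cos b r : 0 < b ->
  (\int[mu]_(y in `]0%R, +oo[) (bell b y * (1 + cos (r * y)))%:E =
   (2^-1 * Num.sqrt (2 * pi / b) * (1 + bell b^-1 r))%:E)%E.
Proof.
move=> b0; pose f y := bell b y * (1 + cos (r * y)).
have cf : continuous f by rewrite /f; contb.
have f0 y : 0 <= f y.
  by rewrite mulr_ge0 ?bell_ge0// -lerBlDl sub0r cos_geN1.
have fN y : f (- y) = f y by rewrite /f bellN mulrN cosN.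
have := integral_half_even cf f0 fN.
have cos1 (z : R) : `|cos z| <= 1 by rewrite ler_norml cos_geN1 cos_le1.
have ib := integrable_bell b0.
have icos : mu.-integrable setT (fun y => (bell b y * cos (r * y))%:E).
  by apply: integrable_bell_mul => //; cont.
have -> : (\int[mu]_x (f x)%:E =
    (Num.sqrt (2 * pi / b) * (1 + bell b^-1 r))%:E)%E.
  rewrite mulrDr mulr1 -bell_fourier// -[X in (X + _)%:E]/(fine (_%:E)) -integral_bell//.
  rewrite -RintegralD// /Rintegral fineK.
    by apply: eq_integral => y _; rewrite /f mulrDr mulr1.
  exact: (integrable_fin_num measurableT (integrableD measurableT ib icos)).
by move=> h; rewrite -mulrA EFinM h muleA -EFinM mulVf ?mul1e.
Qed.

Lemma fine_lebesgue_pipi : fine (mu `[- pi, pi]) = 2 * pi :> R.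
Proof.
have pi0 := pi_gt0 R; rewrite lebesgue_measure_itv/= lte_fin ifT; last by lra.
by rewrite -EFinB/=; ring.
Qed.

Lemma besselJ0E z :
  besselJ0 z = (2 * pi)^-1 * \int[mu]_(s in `[- pi, pi]) cos (z * sin s).
Proof. by rewrite /besselJ0 /besselJ0C /Cintegral /= mul0r subr0. Qed.

Lemma integral_pipi_1cos z :
  \int[mu]_(s in `[- pi, pi]) (1 + cos (z * sin s)) = 2 * pi * (1 + besselJ0 z).
Proof.
have pi0 := pi_gt0 R.
have c1 : continuous (fun _ : R => 1 : R) by cont.
have c2 : continuous (fun s : R => cos (z * sin s)) by cont.
rewrite RintegralD//; [|exact: continuous_locally_integrable..].
rewrite Rintegral_cst// fine_lebesgue_pipi mul1r besselJ0E.
suff H (a I : R) : a != 0 -> a + I = a * (1 + a^-1 * I).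
  by apply: H; rewrite gt_eqF// mulr_gt0.
by move=> a0; field.
Qed.

Lemma integral_besselJ0_atan z :
  (\int[mu]_(x in `]0%R, +oo[)
     ((1 + cos (z * Num.sqrt (1 + x ^+ 2)^-1)) * (1 + x ^+ 2)^-1)%:E =
   (pi / 2 * (1 + besselJ0 z))%:E)%E.
Proof.
(* With w = sin(s)^2 the square root returns |sin s|; the cosine, being even, ignores the sign. *)
pose g (w : R) := 1 + cos (z * Num.sqrt w).
have cg : continuous g by rewrite /g; cont.
have g0 w : 0 <= g w by rewrite -lerBlDl sub0r cos_geN1.
rewrite (integral_circle_atan cg g0); congr EFin.
transitivity (4^-1 * (2 * pi * (1 + besselJ0 z))); last by field.
rewrite -integral_pipi_1cos; congr (_ * _); apply: eq_Rintegral => s _.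
rewrite /g sqrtr_sqr; congr (_ + _).
by case: (ler0P (sin s)) => // _; rewrite mulrN cosN.
Qed.

Lemma le_norm_besselJ0 z : `|besselJ0 z| <= 1.
Proof.
have pi0 := pi_gt0 R.
have cos1 (s : R) : `|cos s| <= 1 by rewrite ler_norml cos_geN1 cos_le1.
have c1 : continuous (fun _ : R => 1 : R) by cont.
have c2 : continuous (fun s : R => cos (z * sin s)) by cont.
have i2 := @continuous_locally_integrable R _ (- pi) pi c2.
rewrite besselJ0E normrM ger0_norm; last by rewrite invr_ge0 mulr_ge0// ltW.
rewrite ler_pdivrMl ?mulr_gt0// mulr1.
apply: (le_trans (le_normr_Rintegral _ i2)) => //.
apply: (@le_trans _ _ (\int[mu]_(s in `[- pi, pi]) 1)).
  apply: le_Rintegral => //; last exact: continuous_locally_integrable.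
  exact: integrable_abse i2.
by rewrite Rintegral_cst// fine_lebesgue_pipi mul1r.
Qed.

Lemma continuous_besselJ0 : continuous (@besselJ0 R).
Proof.
rewrite (_ : @besselJ0 R = fun z => (2 * pi)^-1 * \int[mu]_(s in `[- pi, pi]) cos (z * sin s)); last first.
  by apply/funext => z; rewrite besselJ0E.
apply: contM; first by cont.
move=> z.
have zI : z \in `]z - 1, z + 1[%classic by rewrite inE/= in_itv/=; lra.
have cos1 (s : R) : `|cos s| <= 1 by rewrite ler_norml cos_geN1 cos_le1.
apply: (@continuity_under_integral _ _ _ mu (fun z s => cos (z * sin s)) `[- pi, pi] _
  (z - 1) (z + 1) _ _ (fun _ => 1)) => //.
- move=> u _; apply: continuous_locally_integrable; cont.
- apply: aeW => s _ u _.
  have : continuous (fun z => cos (z * sin s)) by cont.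
  exact.
- by apply: continuous_locally_integrable; cont.
- by move=> u _; exact: aeW.
Qed.

Lemma measurable_besselJ0 : measurable_fun setT (@besselJ0 R).
Proof. by apply: continuous_measurable_fun; exact: continuous_besselJ0. Qed.

(** 1 + J_0 is written as an integral over x, with sin(s)^2 = 1/(1+x^2). Rescaling u by sqrt(1+x^2)
    frees the cosine from x and puts x in a Gaussian of parameter b u^2, whose mass, proportional to
    1/u, cancels the weight u. The Fourier transform of a Gaussian remains. *)
Lemma weber1 b r : 0 < b ->
  (\int[mu]_(u in `]0%R, +oo[) (u * bell b u * (1 + besselJ0 (r * u)))%:E =
   (b^-1 * (1 + bell b^-1 r))%:E)%E.
Proof.
move=> b0; have pi0 := pi_gt0 R.
pose q x := Num.sqrt (1 + x ^+ 2).
have q2 x : q x ^+ 2 = 1 + x ^+ 2 by rewrite sqr_sqrtr// addr_ge0// sqr_ge0.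
have q0 x : 0 < q x by rewrite sqrtr_gt0 ltr_pwDl// sqr_ge0.
have qV x : Num.sqrt (1 + x ^+ 2)^-1 = (q x)^-1.
  by rewrite sqrtrV// addr_ge0// sqr_ge0.
have cos0 (z : R) : 0 <= 1 + cos z by rewrite -lerBlDl sub0r cos_geN1.
have x20 x : 0 <= (1 + x ^+ 2)^-1 by rewrite invr_ge0 addr_ge0// sqr_ge0.
(* The norm of [z.1] makes [f] nonnegative on the whole plane, as [tonelli] requires; it changes
   nothing on the half-line. *)
pose f (z : R * R) := `|z.1| * bell b z.1 *
  ((1 + cos (r * z.1 * Num.sqrt (1 + z.2 ^+ 2)^-1)) * (1 + z.2 ^+ 2)^-1).
have mf : measurable_fun setT (EFin \o f).
  by apply/measurable_EFinP; rewrite /f /bell; meas.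
have f0 (z : R * R) : (0 <= (EFin \o f) z)%E by rewrite lee_fin !mulr_ge0 ?bell_ge0.
pose h (z : R * R) := `|z.1| * bell b z.1 * (1 + cos (r * z.1)) *
  bell (b * z.1 ^+ 2) z.2.
have mh : measurable_fun setT (EFin \o h).
  by apply/measurable_EFinP; rewrite /h /bell; meas.
have h0 (z : R * R) : (0 <= (EFin \o h) z)%E by rewrite lee_fin !mulr_ge0 ?bell_ge0.
have main : (\int[mu]_(u in `]0%R, +oo[) (pi / 2 * (u * bell b u * (1 + besselJ0 (r * u))))%:E =
    (pi / 2 * (b^-1 * (1 + bell b^-1 r)))%:E)%E.
  transitivity (\int[mu]_(u in `]0%R, +oo[) \int[mu]_(x in `]0%R, +oo[) (EFin \o f) (u, x))%E.
    apply: eq_integral => u; rewrite inE/= in_itv/= andbT => u0.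
    rewrite mulrCA EFinM -integral_besselJ0_atan -ge0_integralZl//=.
    - by apply: eq_integral => x _; rewrite -EFinM /f/= gtr0_norm.
    - by apply/measurable_EFinP/measurable_funTS; meas.
    - by move=> x _; rewrite lee_fin mulr_ge0.
    - by rewrite lee_fin mulr_ge0 ?bell_ge0// ltW.
  rewrite tonelli//.
  transitivity (\int[mu]_(x in `]0%R, +oo[) \int[mu]_(u in `]0%R, +oo[) (EFin \o h) (u, x))%E.
    apply: eq_integral => x _.
    (* The Jacobian [q x] and the factor [q x] of the weight cancel the density [(q x)^-2]. *)
    rewrite (@ge0_integral_scale (q x) (fun u => (EFin \o f) (u, x)) (q0 x)
      (measurable_fun_pair1 x mf) (fun u => f0 (u, x))).
    rewrite -ge0_integralZl//=; last 3 first.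
    - by apply/measurable_EFinP/measurable_funTS; rewrite /f /bell /=; meas.
    - by move=> u _; exact: (f0 (q x * u, x)).
    - by rewrite lee_fin ltW.
    apply: eq_integral => u; rewrite inE/= in_itv/= andbT => u0.
    rewrite -EFinM /f /h /= qV; congr EFin.
    have -> : r * (q x * u) * (q x)^-1 = r * u by field; rewrite gt_eqF.
    have -> : bell b (q x * u) = bell b u * bell (b * u ^+ 2) x.
      by rewrite /bell -expRD exprMn q2; congr expR; ring.
    rewrite -q2 normrM (gtr0_norm (q0 x)); field; rewrite gt_eqF//.
  rewrite -tonelli//.
  (* On the half-line the Gaussian in x has mass sqrt(2 pi / b) / (2 u). *)
  transitivity (\int[mu]_(u in `]0%R, +oo[) ((2^-1 * Num.sqrt (2 * pi / b))%:E *
      (bell b u * (1 + cos (r * u)))%:E))%E.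
    apply: eq_integral => u; rewrite inE/= in_itv/= andbT => u0.
    transitivity (\int[mu]_(x in `]0%R, +oo[) ((`|u| * bell b u * (1 + cos (r * u)))%:E *
        (bell (b * u ^+ 2) x)%:E))%E.
      by apply: eq_integral => x _; rewrite /h/= EFinM.
    rewrite ge0_integralZl//=; last 3 first.
    - by apply/measurable_EFinP/measurable_funTS; exact: measurable_bell.
    - by move=> x _; rewrite lee_fin bell_ge0.
    - by rewrite lee_fin !mulr_ge0 ?bell_ge0.
    rewrite integral_bell_half ?mulr_gt0 ?exprn_gt0// -!EFinM; congr EFin.
    have -> : 2 * pi / (b * u ^+ 2) = 2 * pi / b * (u^-1) ^+ 2 by field; rewrite !gt_eqF.
    rewrite sqrtrM ?divr_ge0 ?mulr_ge0 ?ltW// sqrtr_sqr (gtr0_norm u0).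
    have uV0 : 0 < u^-1 by rewrite invr_gt0.
    by rewrite (gtr0_norm uV0); field; rewrite gt_eqF.
  rewrite ge0_integralZl//=.
  - rewrite integral_bell_1cos// -EFinM; congr EFin.
    rewrite mulrA (_ : 2^-1 * _ * _ = 2^-1 ^+ 2 * Num.sqrt (2 * pi / b) ^+ 2); last by ring.
    rewrite sqr_sqrtr ?divr_ge0 ?mulr_ge0 ?ltW//; field; rewrite gt_eqF//.
  - by apply/measurable_EFinP/measurable_funTS; rewrite /bell; meas.
  - by move=> u _; rewrite lee_fin mulr_ge0 ?bell_ge0.
move: main; under eq_integral do rewrite EFinM.
have mJ : measurable_fun setT (fun u => 1 + besselJ0 (r * u)).
  apply: measurable_funD => //; apply: (measurableT_comp measurable_besselJ0).
  by meas.
have J0 (z : R) : 0 <= 1 + besselJ0 z.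
  by have := le_norm_besselJ0 z; rewrite ler_norml; lra.
rewrite ge0_integralZl//=.
- rewrite (EFinM (pi / 2) (b^-1 * _)) => /(congr1 (fun x : \bar R => (pi / 2)^-1%:E * x)%E).
  by rewrite !muleA -EFinM mulVf ?mul1e// gt_eqF// divr_gt0.
- apply/measurable_EFinP/measurable_funTS/measurable_funM => //.
  by apply: measurable_funM => //; exact: measurable_bell.
- move=> u; rewrite in_itv/= andbT => u0.
  by rewrite lee_fin !mulr_ge0 ?bell_ge0// ltW.
- by rewrite lee_fin divr_ge0// ltW.
Qed.

Lemma integrable_mul_bell_half b : 0 < b ->
  mu.-integrable `]0, +oo[ (fun u => (u * bell b u)%:E).
Proof.
move=> b0.
have i : mu.-integrable `]0, +oo[ (fun y => (`|y| * bell b y)%:E).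
  by apply: integrableS (integrable_mul_bell b0).
apply: eq_integrable i => // u; rewrite inE/= in_itv/= andbT => u0.
by rewrite gtr0_norm.
Qed.

Lemma integrable_weber b r : 0 < b ->
  mu.-integrable `]0, +oo[ (fun u => (u * bell b u * besselJ0 (r * u))%:E).
Proof.
move=> b0; apply: (le_integrable _ _ _ (integrable_mul_bell_half b0)) => //.
  apply/measurable_EFinP/measurable_funTS/measurable_funM.
    by apply: measurable_funM => //; exact: measurable_bell.
  by apply: (measurableT_comp measurable_besselJ0); meas.
by move=> u _; rewrite lee_fin normrM ler_piMr// le_norm_besselJ0.
Qed.

(** At r = 0, where J_0 = 1, [weber1] evaluates the integral of [u * bell b u], which is then
    subtracted from the general case. *)
Lemma weber b r : 0 < b ->
  \int[mu]_(u in `]0, +oo[) (u * bell b u * besselJ0 (r * u)) = b^-1 * bell b^-1 r.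
Proof.
move=> b0; have i1 := integrable_mul_bell_half b0.
have W s : \int[mu]_(u in `]0, +oo[) (u * bell b u) +
    \int[mu]_(u in `]0, +oo[) (u * bell b u * besselJ0 (s * u)) =
    b^-1 * (1 + bell b^-1 s).
  rewrite -RintegralD//; last exact: integrable_weber.
  under eq_Rintegral do rewrite -[X in X + _]mulr1 -mulrDr.
  by rewrite /Rintegral weber1.
have J1 : besselJ0 (0 : R) = 1.
  have pi0 := pi_gt0 R; rewrite besselJ0E.
  under eq_Rintegral do rewrite mul0r cos0.
  by rewrite Rintegral_cst// fine_lebesgue_pipi mul1r mulVf// gt_eqF// mulr_gt0.
have := W 0; have := W r; rewrite bell_at0.
under [X in _ -> _ + X = _ -> _]eq_Rintegral do rewrite mul0r J1 mulr1.
suff H (A B c e : R) : A + B = c * (1 + e) -> A + A = c * (1 + 1) -> B = c * e.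
  exact: H.
by move=> h1 h2; lra.
Qed.

End weber.

(** * Equidistribution of the fast phase *)

Section equidistribution.
Context {R : realType}.
Local Notation mu := (@lebesgue_measure R).

(* Heine-Cantor along the segment [a * [-1, 1]], in the form of a sequence of
   bounded factors [y n] for which no limit is assumed. *)
Lemma cvg_unif_scale (g : R -> R) (a : R) (x y : nat -> R) : continuous g ->
  (forall n, `|y n| <= 1) -> x n @[n --> \oo] --> a ->
  g (x n * y n) - g (a * y n) @[n --> \oo] --> 0.
Proof.
move=> cg y1 xa; apply/cvgrPdist_lt => e e0.
(* Joint continuity at (z, a) gives neighbourhoods of a depending on z; compactness provides one
   that serves all z in [-1, 1]. *)
have /compact_near_coveringP cov : compact `[(-1 : R), 1] by exact: segment_compact.
have e20 : 0 < e / 2 by rewrite divr_gt0.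
have near_z (z : R) : \forall z' \near z & x' \near nbhs a,
    `|g (x' * z') - g (a * z')| < e.
  have c1 : g (p.2 * p.1) @[p --> (z, a)] --> g (a * z).
    apply: (@cvg_comp _ _ _ (fun p : R * R => p.2 * p.1) g _ (nbhs (a * z))).
      by apply: cvgM; [exact: cvg_snd|exact: cvg_fst].
    exact: cg.
  have c2 : g (a * p.1) @[p --> (z, a)] --> g (a * z).
    apply: (@cvg_comp _ _ _ (fun p : R * R => a * p.1) g _ (nbhs (a * z))).
      by apply: cvgM; [exact: cvg_cst|exact: cvg_fst].
    exact: cg.
  move/cvgrPdist_lt : c1 => /(_ _ e20) c1; move/cvgrPdist_lt : c2 => /(_ _ e20) c2.
  near=> p => /=.
  have h1 : `|g (a * z) - g (p.2 * p.1)| < e / 2 by near: p.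
  have h2 : `|g (a * z) - g (a * p.1)| < e / 2 by near: p.
  rewrite -(subrKA (g (a * z))) (le_lt_trans (ler_normD _ _))//.
  by rewrite (distrC (g (p.2 * p.1))); lra.
have near_a : \forall x' \near a, `[(-1 : R), 1] `<=`
    (fun z => `|g (x' * z) - g (a * z)| < e).
  apply: (cov R (nbhs a) (fun x' z => `|g (x' * z) - g (a * z)| < e)) => z _.
  exact: near_z.
have := xa _ near_a; rewrite !near_simpl /= => xn.
near=> n; rewrite sub0r normrN.
have : `[(-1 : R), 1] `<=` (fun z => `|g (x n * z) - g (a * z)| < e) by near: n.
by apply; rewrite /= in_itv/= -ler_norml.
Unshelve. all: end_near. Qed.

Lemma ae_imp d (T : measurableType d) (m : {measure set T -> \bar R}) (P Q : set T) :
  (forall x, P x -> Q x) -> {ae m, forall x, P x} -> {ae m, forall x, Q x}.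
Proof. by move=> PQ; exact: filterS. Qed.

Lemma ae_neq2 (a b : R) : {ae mu, forall u : R, u != a /\ u != b}.
Proof.
have negl1 (c : R) : mu.-negligible [set c].
  by exists [set c]; split => //; exact: lebesgue_measure_set1.
apply: negligibleS (negligibleU (negl1 a) (negl1 b)) => u /=.
have [->|ua] := eqVneq u a; first by left.
have [->|ub] := eqVneq u b; first by right.
by move=> /(_ (conj isT isT)).
Qed.

Let I01 : set R := `]0, 1[%classic.

Variables (K g : R -> R) (M : R).
Hypothesis cK : {in I01, continuous K}.
Hypothesis mK : measurable_fun setT K.
Hypothesis cg : continuous g.
Hypothesis gM : forall x, `|g x| <= M.

(** The indicator lets u range over the whole line, so that translating u creates no boundary
    terms. *)
Let Phi (u s : R) := \1_I01 u * g (K u * sin s).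

Let measurable_Phi d (T : measurableType d) (p q : T -> R) :
  measurable_fun setT p -> measurable_fun setT q ->
  measurable_fun setT (fun z => Phi (p z) (q z)).
Proof.
move=> mp mq; apply: measurable_funM.
  have mi : measurable_fun setT (\1_I01 : R -> R) by rewrite /I01; exact: measurable_indic.
  exact: measurableT_comp mi mp.
apply: (measurable_cont_comp cg); apply: measurable_funM.
  exact: measurableT_comp mK mp.
by meas.
Qed.

Let M0 : 0 <= M. Proof. by rewrite (le_trans _ (gM 0)). Qed.

Let Phi_le u s : `|Phi u s| <= M * \1_I01 u.
Proof.
have i0 : 0 <= \1_I01 u :> R by rewrite indicE.
by rewrite normrM (ger0_norm i0) mulrC ler_wpM2r.
Qed.

(** The window contains every u such that u or u + s/n lies in ]0, 1[, for |s| <= pi and n >= 1;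
    each of the two terms of [D] contributes one M. *)
Let dom (u : R) := (M + M) * \1_(`[- pi, 1 + pi] : set R) u.

Let integrable_dom : mu.-integrable setT (EFin \o dom).
Proof.
exact: (integrableZl measurableT (M + M) (integrable_indic_itv _ _ _ _)).
Qed.

Let integrable_Phi0 : mu.-integrable setT (EFin \o (fun u => M * \1_I01 u)).
Proof.
exact: (integrableZl measurableT M (integrable_indic_itv _ _ _ _)).
Qed.

Let integrable_Phi (p q : R -> R) (b : R) :
  measurable_fun setT q -> p =1 (fun u => 1 * u + b) ->
  mu.-integrable setT (EFin \o (fun u => Phi (p u) (q u))).
Proof.
move=> mq pE; apply: (le_integrable _ _ _ (integrable_affine b (oner_neq0 R) integrable_Phi0)) => //.
  apply/measurable_EFinP/measurable_Phi => //.
  by rewrite (funext pE); exact: measurable_affine.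
by move=> u _; rewrite lee_fin pE (le_trans (Phi_le _ _))// ler_norm.
Qed.

Let Rintegral_pipi_cst (c : R) : \int[mu]_(s in `[- pi, pi]) c = 2 * pi * c.
Proof. by rewrite Rintegral_cst// fine_lebesgue_pipi mulrC. Qed.

Let cst_pipi (c : R) : mu.-integrable `[- pi, pi] (EFin \o (fun _ : R => c)).
Proof. by apply: continuous_locally_integrable; cont. Qed.

(* Difference between the integrand translated by [s / n] and the integrand
   with frozen slow variable. *)
Let D n (z : R * R) :=
  Phi (1 * z.2 + z.1 / n%:R) (n%:R * (1 * z.2 + z.1 / n%:R)) - Phi z.2 (1 * z.1 + n%:R * z.2).

Let measurable_D n : measurable_fun setT (D n).
Proof.
by apply: measurable_funB; apply: measurable_Phi; meas.
Qed.

Let shift_fact n (s u : R) : (0 < n)%N -> n%:R * (1 * u + s / n%:R) = 1 * s + n%:R * u.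
Proof. by move=> n0; field; rewrite pnatr_eq0 -lt0n. Qed.

Let D_le n s u : (0 < n)%N -> `[- pi, pi]%classic s -> `|D n (s, u)| <= 1 * dom u.
Proof.
move=> n0; rewrite /= in_itv/= => /andP[s1 s2].
have pi0 := pi_gt0 R.
rewrite mul1r /D/= (le_trans (ler_normB _ _))// /dom mulrDl.
have n1 : 1 <= n%:R :> R by rewrite ler1n.
have nV0 : 0 < (n%:R : R)^-1 by rewrite invr_gt0; lra.
have nV1 : (n%:R : R)^-1 <= 1 by rewrite invf_le1//; lra.
have sub (v : R) : `|v - u| <= pi -> \1_I01 v <= \1_(`[- pi, 1 + pi] : set R) u :> R.
  rewrite ler_norml => /andP[v1 v2]; rewrite !indicE; case: (boolP (v \in I01)) => //.
  move=> /set_mem; rewrite /I01/= in_itv/= => /andP[v3 v4].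
  by rewrite mem_set//= in_itv/=; apply/andP; split; lra.
apply: lerD.
  apply: (le_trans (Phi_le _ _)); apply: ler_wpM2l => //; apply: sub.
  rewrite mul1r addrC addKr normrM (gtr0_norm nV0).
  have : `|s| <= pi by rewrite ler_norml s1 s2.
  by have := normr_ge0 s; nra.
apply: (le_trans (Phi_le _ _)); apply: ler_wpM2l => //; apply: sub.
by rewrite subrr normr0 ltW.
Qed.

(** Both terms of [D] carry the same oscillating factor sin(s + n u), and only K(u + s/n) moves,
    towards K(u). The factor has no limit, which is why [cvg_unif_scale] assumes none. *)
Let cvg_D s u : u != 0 -> u != 1 -> D n (s, u) @[n --> \oo] --> 0.
Proof.
move=> u0 u1; have inv0 : s / n%:R @[n --> \oo] --> 0.
  rewrite -[X in _ --> X](mulr0 s); apply: cvgM; first exact: cvg_cst.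
  apply/gtr0_cvgV0; last exact: cvgr_idn.
  by near=> n; rewrite ltr0n; near: n; exact: nbhs_infty_gt.
have shift : 1 * u + s / n%:R @[n --> \oo] --> u.
  rewrite -[X in _ --> X]addr0 -{2}(mul1r u).
  by apply: cvgD => //; exact: cvg_cst.
have [uI|uI] := boolP (u \in I01).
  have near_in : \forall n \near \oo, 1 * u + s / n%:R \in I01.
    have : \forall v \near u, v \in I01; last by move=> /shift.
    near=> v; apply: mem_set; rewrite /I01; near: v.
    by apply: near_in_itvoo; exact: set_mem uI.
  have KK : K (1 * u + s / n%:R) @[n --> \oo] --> K u.
    exact: (cvg_comp _ _ shift (cK uI)).
  have sin1 n : `|sin (1 * s + n%:R * u)| <= 1 by rewrite ler_norml sin_geN1 sin_le1.
  have := cvg_unif_scale cg sin1 KK.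
  apply: cvg_trans; apply: near_eq_cvg; near=> n.
  have n0 : (0 < n)%N by near: n; exact: nbhs_infty_gt.
  have nI : 1 * u + s / n%:R \in I01 by near: n.
  by rewrite /D/= shift_fact// /Phi !indicE uI nI !mul1r.
(* For u outside the closed unit interval both indicators vanish for large n. *)
apply: cvg_near_cst.
have : \forall v \near u, v \notin I01.
  move: uI; rewrite notin_setE /I01/= in_itv/= => /negP.
  rewrite negb_and -!leNgt => /orP[u_le0|u_ge1].
    have ult0 : u < 0 by rewrite lt_neqAle u0.
    near=> v; rewrite notin_setE /I01/= in_itv/= => /andP[v0 _].
    have : v < 0 by near: v; exact: lt_nbhsl.
    by lra.
  have ugt1 : 1 < u by rewrite lt_neqAle eq_sym u1.
  near=> v; rewrite notin_setE /I01/= in_itv/= => /andP[_ v1].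
  have : 1 < v by near: v; exact: lt_nbhsr.
  by lra.
move=> /shift; rewrite !near_simpl/= => nI.
near=> n; have nI' : 1 * u + s / n%:R \notin I01 by near: n.
by rewrite /D/= /Phi !indicE (negbTE uI) (negbTE nI') !mul0r subrr.
Unshelve. all: end_near. Qed.

(** Dominated convergence is applied in u and then in s; the index [n.+1] avoids the division by 0
    in [s / n%:R]. *)
Let cvg_int_D : \int[mu]_(s in `[- pi, pi]) \int[mu]_u D n.+1 (s, u)
  @[n --> \oo] --> 0.
Proof.
have pipi0 : \int[mu]_(s in `[(- pi : R), pi]) 0 = 0.
  by rewrite Rintegral_cst// mul0r.
have one := cst_pipi 1.
rewrite -[X in _ --> X]pipi0.
apply: (@Rdominated_cvg _ _ R mu `[- pi, pi] (fun n s => \int[mu]_u D n.+1 (s, u))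
  (fun _ => 0) (fun _ => \int[mu]_u dom u)) => //.
- move=> n.
  have := @integrable_fubini1 _ _ _ _ R mu mu `[- pi, pi] setT
    (measurable_itv _) measurableT (D n.+1) (fun _ => 1) dom (measurable_D _) one integrable_dom
    (fun s u hs _ => D_le u (ltn0Sn n) hs).
  by case/integrableP => /measurable_EFinP.
- apply: aeW => s hs.
  have z0 : \int[mu]_(u in [set: R]) 0 = 0.
    by rewrite /Rintegral integral0.
  rewrite -[X in _ --> X]z0.
  apply: (@Rdominated_cvg _ _ R mu setT (fun n u => D n.+1 (s, u)) (fun _ => 0) dom) => //.
  + by move=> n; exact: (measurable_fun_pair2 s (measurable_D _)).
  + apply: ae_imp (ae_neq2 0 1) => u [u0 u1] _.
    have := @cvg_D s u u0 u1.
    by rewrite -(cvg_shiftS (fun n => D n (s, u))).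
  + by move=> n u _; have := D_le u (ltn0Sn n) hs; rewrite mul1r.
- move=> n s hs.
  have iD : mu.-integrable setT (EFin \o (fun u => D n.+1 (s, u))).
    apply: (le_integrable _ _ _ integrable_dom) => //.
      by apply/measurable_EFinP; exact: (measurable_fun_pair2 s (measurable_D _)).
    move=> u _; have := D_le u (ltn0Sn n) hs; rewrite mul1r lee_fin => /le_trans; apply.
    exact: ler_norm.
  apply: (le_trans (le_normr_Rintegral measurableT iD)).
  apply: le_Rintegral => //; first exact: integrable_abse iD.
  by move=> u _; have := D_le u (ltn0Sn n) hs; rewrite mul1r.
Qed.

(** By translation invariance the first term of [D] has the same u-integral for every s, hence the
    factor 2 pi. In the second, Fubini and the periodicity of the sine remove the phase n u. *)
Let int_D n : (0 < n)%N ->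
  \int[mu]_(s in `[- pi, pi]) \int[mu]_u D n (s, u) =
  2 * pi * (\int[mu]_u Phi u (n%:R * u)) -
  \int[mu]_(u in setT) \int[mu]_(s in `[- pi, pi]) Phi u s.
Proof.
move=> n0; have pi0 := pi_gt0 R.
have mlin (c : R) : measurable_fun setT (fun u => c * u) by meas.
have i1 s : mu.-integrable setT
    (EFin \o (fun u => Phi (1 * u + s / n%:R) (n%:R * (1 * u + s / n%:R)))).
  by apply: (@integrable_Phi _ _ (s / n%:R)) => //; meas.
have i2 s : mu.-integrable setT (EFin \o (fun u => Phi u (1 * s + n%:R * u))).
  by apply: (@integrable_Phi _ _ 0); [meas|by move=> u /=; ring].
have i0 : mu.-integrable setT (EFin \o (fun u => Phi u (n%:R * u))).
  by apply: (@integrable_Phi _ _ 0); [meas|by move=> u /=; ring].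
have E1 s : \int[mu]_u Phi (1 * u + s / n%:R) (n%:R * (1 * u + s / n%:R)) =
    \int[mu]_u Phi u (n%:R * u).
  by rewrite (Rintegral_affine (s / n%:R) (oner_neq0 R) i0) normr1 mul1r.
have mPhi2 : measurable_fun setT (fun z : R * R => Phi z.2 (1 * z.1 + n%:R * z.2)).
  by apply: measurable_Phi; meas.
have bPhi2 (s u : R) : `[- pi, pi]%classic s -> setT u ->
    `|Phi u (1 * s + n%:R * u)| <= 1 * (M * \1_I01 u).
  by move=> _ _; rewrite [leRHS]mul1r; exact: Phi_le.
have one := cst_pipi 1.
have i3 := @integrable_fubini1 _ _ _ _ R mu mu `[- pi, pi] setT
    (measurable_itv _) measurableT (fun z => Phi z.2 (1 * z.1 + n%:R * z.2))
    (fun _ => 1) (fun u => M * \1_I01 u) mPhi2 one integrable_Phi0 bPhi2.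
have F := @Rfubini _ _ _ _ R mu mu `[- pi, pi] setT
    (measurable_itv _) measurableT (fun z => Phi z.2 (1 * z.1 + n%:R * z.2)) (fun _ => 1) (fun u => M * \1_I01 u)
    mPhi2 one integrable_Phi0 bPhi2.
transitivity (\int[mu]_(s in `[- pi, pi]) (\int[mu]_u Phi u (n%:R * u) -
    \int[mu]_u Phi u (1 * s + n%:R * u))).
  by apply: eq_Rintegral => s _; rewrite /D/= (RintegralB measurableT (i1 s) (i2 s)) E1.
transitivity (\int[mu]_(s in `[- pi, pi]) (\int[mu]_u Phi u (n%:R * u)) -
    \int[mu]_(s in `[- pi, pi]) (\int[mu]_u Phi u (1 * s + n%:R * u))).
  by apply: RintegralB => //; exact: cst_pipi.
rewrite Rintegral_pipi_cst; congr (_ - _); rewrite F; apply: eq_Rintegral => u _ /=.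
apply: (@Rintegral_periodic R (Phi u) (- pi) pi (n%:R * u)).
- rewrite /Phi; apply: contM; first by cont.
  by apply: continuous_comp1 => //; cont.
- by lra.
- move=> s; have -> : s + (pi - - pi) = s + pi *+ 2 by ring.
  by rewrite /Phi sinD2pi.
Qed.

(** Moving u by s/n shifts the phase n u by s while K(u) hardly changes; averaging over one period
    of s therefore makes the phase uniform and independent of u. *)
Lemma equidistribution :
  \int[mu]_(u in `]0, 1[) g (K u * sin (n%:R * u)) @[n --> \oo] -->
  (2 * pi)^-1 * \int[mu]_(u in `]0, 1[) \int[mu]_(s in `[- pi, pi]) g (K u * sin s).
Proof.
have tp0 : 2 * pi != 0 :> R by rewrite gt_eqF// mulr_gt0// pi_gt0.
have restr (h : R -> R) : \int[mu]_(u in `]0, 1[) h u = \int[mu]_u (\1_I01 u * h u).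
  rewrite Rintegral_mkcond; apply: eq_Rintegral => u _.
  by rewrite patchE indicE /I01; case: ifPn => uI; rewrite ?(mul1r, mul0r).
have E n : \int[mu]_(u in `]0, 1[) g (K u * sin (n.+1%:R * u)) =
    (2 * pi)^-1 * (\int[mu]_(s in `[- pi, pi]) \int[mu]_u D n.+1 (s, u)) +
    (2 * pi)^-1 * \int[mu]_u \int[mu]_(s in `[- pi, pi]) Phi u s.
  by rewrite int_D// mulrBr mulKf// subrK restr.
have cs u : mu.-integrable `[- pi, pi] (EFin \o (fun s => g (K u * sin s))).
  by apply: continuous_locally_integrable; apply: continuous_comp1 => //; cont.
have T : \int[mu]_(u in `]0, 1[) \int[mu]_(s in `[- pi, pi]) g (K u * sin s) =
    \int[mu]_u \int[mu]_(s in `[- pi, pi]) Phi u s.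
  by rewrite restr; apply: eq_Rintegral => u _; rewrite -RintegralZl.
rewrite -(@cvg_shiftS _ (fun n => \int[mu]_(u in `]0, 1[) g (K u * sin (n%:R * u)))).
under eq_fun do rewrite E.
rewrite T.
have l0 : (2 * pi)^-1 * \int[mu]_(s in `[- pi, pi]) \int[mu]_u D n.+1 (s, u)
    @[n --> \oo] --> (2 * pi)^-1 * 0.
  by apply: cvgM; [exact: cvg_cst|exact: cvg_int_D].
have := cvgD l0 (cvg_cst ((2 * pi)^-1 * \int[mu]_u \int[mu]_(s in `[- pi, pi]) Phi u s)).
by rewrite mulr0 add0r; exact.
Qed.

End equidistribution.

(** * Symmetric measures tested on Gaussians *)

Section density.
Context {R : realType}.
Local Notation mu := (@lebesgue_measure R).
Variable f : R -> R.
Hypothesis f0 : forall y, 0 <= f y.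
Hypothesis mf : measurable_fun setT f.

(** Defined for any real [f]; the sign of [f] enters only through the measure structure declared
    below. *)
Definition density (A : set R) : \bar R := (\int[mu]_(y in A) (f y)%:E)%E.

Let density0 : density set0 = 0%E.
Proof. by rewrite /density integral_set0. Qed.

Let density_ge0 A : (0 <= density A)%E.
Proof. by apply: integral_ge0 => y _; rewrite lee_fin. Qed.

Let density_sigma_additive : semi_sigma_additive density.
Proof.
move=> /= F mF tF mUF; rewrite /density; apply: cvg_toP.
  apply: ereal_nondecreasing_is_cvgn => m n mn.
  by apply: lee_sum_nneg_natr => // k _ _; exact: density_ge0.
rewrite ge0_integral_bigcup//=.
- by apply/measurable_EFinP; exact: measurable_funTS.
- by move=> y _; rewrite lee_fin.
Qed.

HB.instance Definition _ := isMeasure.Build _ _ _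
  density density0 density_ge0 density_sigma_additive.

End density.

Section symmetric_measures.
Context {R : realType}.
Implicit Type m : {measure set R -> \bar R}.

Let measurable_opp (A : set R) : measurable A -> measurable (-%R @^-1` A).
Proof.
move=> mA; rewrite -[X in measurable X]setTI.
have mo : measurable_fun setT (-%R : R -> R).
  by apply: continuous_measurable_fun; exact: opp_continuous.
exact: mo.
Qed.

Let tail m (x : R) : (forall A : set R, measurable A -> m (-%R @^-1` A) = m A) -> 0 <= x ->
  (m [set y | (x < `|y|)%R] = m `]x, +oo[%classic + m `]x, +oo[%classic)%E.
Proof.
move=> sm x0; have mI : measurable (`]x, +oo[%classic : set R) by [].
rewrite -[X in (_ + X)%E](sm _ mI) -measureU//; last 2 first.
- exact: measurable_opp.
- apply/seteqP; split => y //=; rewrite !in_itv/= !andbT => -[]; lra.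
congr (m _); apply/seteqP; split => y /=; rewrite !in_itv/= !andbT ltr_normr.
  by case/orP => h; [left|right => /=]; rewrite ?in_itv/= ?andbT.
by case => ->; rewrite ?orbT.
Qed.

(** By symmetry a tail {|y| > x} has twice the mass of the ray above x, and rays generate the Borel
    sets of the positive half-line. Reflection handles negative points; the atom at 0 is the total
    mass minus the tail at 0. *)
Lemma symmetric_measure_unique m1 m2 : (m1 setT < +oo)%E -> m1 setT = m2 setT ->
  (forall A : set R, measurable A -> m1 (-%R @^-1` A) = m1 A) ->
  (forall A : set R, measurable A -> m2 (-%R @^-1` A) = m2 A) ->
  (forall x : R, 0 <= x -> m1 [set y | x < `|y|] = m2 [set y | x < `|y|]) ->
  forall A : set R, measurable A -> m1 A = m2 A.
Proof.
move=> m1fin m12 sm1 sm2 m12x.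
have fin1 (A : set R) : measurable A -> m1 A \is a fin_num.
  move=> mA; rewrite ge0_fin_numE// (le_lt_trans _ m1fin)//.
  by apply: le_measure; rewrite ?inE.
have fin2 (A : set R) : measurable A -> m2 A \is a fin_num.
  move=> mA; rewrite ge0_fin_numE// (@le_lt_trans _ _ (m2 setT))//.
    by apply: le_measure; rewrite ?inE.
  by rewrite -m12.
have ray (x : R) : 0 <= x -> m1 `]x, +oo[%classic = m2 `]x, +oo[%classic.
  move=> x0; have := m12x x x0; rewrite !tail//.
  rewrite -(fineK (fin1 `]x, +oo[%classic _))// -(fineK (fin2 `]x, +oo[%classic _))//.
  by rewrite -!EFinD => -[h]; congr EFin; lra.
pose pos : set R := `]0, +oo[%classic.
have mpos : measurable pos by exact: measurable_itv.
(* Restricting to [pos] turns a generating ray with any real endpoint x into the ray above max(x,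
   0), where the measures agree. *)
have eq_pos (A : set R) : measurable A -> m1 (A `&` pos) = m2 (A `&` pos).
  pose n1 : {measure set R -> \bar R} := mrestr m1 mpos.
  pose n2 : {measure set R -> \bar R} := mrestr m2 mpos.
  move=> mA; apply: (@measure_unique _ R _ (@RGenOInfty.G R)
    (fun n => `](- n%:R), +oo[%classic) _ _ _ _ n1 n2) => //.
  - exact: RGenOInfty.measurableE.
  - move=> _ _ [x ->] [y ->]; exists (Num.max x y).
    apply/seteqP; split => z /=; rewrite !in_itv/= !andbT gt_max.
      by move=> [-> ->].
    by move=> /andP[-> ->].
  - by move=> n; exists (- n%:R).
  - apply/seteqP; split => // y _; exists (Num.truncn `|y|).+1 => //=.
    rewrite in_itv/= andbT ltrNl (le_lt_trans (ler_norm _))// normrN.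
    exact: truncnS_gt.
  - move=> _ [x ->]; rewrite /n1 /n2 /= /mrestr.
    have -> : `]x, +oo[ `&` pos = `]Num.max x 0, +oo[%classic.
      apply/seteqP; split => z /=; rewrite /pos/= !in_itv/= !andbT gt_max.
        by move=> [-> ->].
      by move=> /andP[-> ->].
    by apply: ray; rewrite le_max lexx orbT.
  - move=> n; rewrite /n1/= /mrestr -ge0_fin_numE//.
    by apply: fin1; exact: measurableI.
have eq0 : m1 [set 0] = m2 [set 0].
  have T0 : [set: R] = [set 0] `|` [set y | 0 < `|y|].
    apply/seteqP; split => // y _ /=; rewrite normr_gt0.
    by have [->|y0] := eqVneq y 0; [left|right].
  have mn : measurable [set y : R | 0 < `|y|].
    have -> : [set y : R | 0 < `|y|] = ~` [set 0].
      apply/seteqP; split => y /=; rewrite normr_gt0; first by move=> /eqP.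
      by move=> /eqP.
    exact: measurableC.
  have dis : [set 0] `&` [set y : R | 0 < `|y|] = set0.
    by apply/seteqP; split => y //= [->]; rewrite normr0 ltxx.
  have m0 : m1 [set y : R | 0 < `|y|] = m2 [set y : R | 0 < `|y|] := m12x 0 (lexx 0).
  move: m12; rewrite T0 (measureU _ _ mn dis)// [in RHS](measureU _ _ mn dis)//.
  move=> h.
  have h2 := etrans (congr1 (fun z : \bar R => (m1 [set 0%R] + z)%E) (esym m0)) h.
  by rewrite -[LHS](addeK _ (fin2 _ mn)) h2 addeK// fin2.
move=> A mA.
pose A' : set R := -%R @^-1` A.
have mA' : measurable A' by exact: measurable_opp.
have AE : A = (A `&` pos) `|` ((-%R @^-1` (A' `&` pos)) `|` (A `&` [set 0])).
  apply/seteqP; split => y /=.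
    rewrite /pos/= !in_itv/= !andbT => Ay; have [y0|y0|y0] := ltgtP y 0.
    - by right; left; rewrite /A'/= opprK; split => //; lra.
    - by left.
    - by right; right.
  by move=> [[]//|[[]|[]//]]; rewrite /A'/= opprK.
have m3 : measurable (-%R @^-1` (A' `&` pos)).
  by apply: measurable_opp; exact: measurableI.
have m4 : measurable (A `&` [set 0]) by exact: measurableI.
have m5 : measurable (A `&` pos) by exact: measurableI.
have d1 : -%R @^-1` (A' `&` pos) `&` (A `&` [set 0]) = set0.
  apply/seteqP; split => y //= [[_ +] [_ y0]].
  by rewrite /pos/= y0 in_itv/= oppr0 ltxx.
have d2 : (A `&` pos) `&` ((-%R @^-1` (A' `&` pos)) `|` (A `&` [set 0])) = set0.
  apply/seteqP; split => y //= [[_ +]]; rewrite /pos/= in_itv/= andbT => y0.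
  move=> [[_]|[_ y00]]; first by rewrite /pos/= in_itv/= andbT; lra.
  by move: y0; rewrite y00 ltxx.
have eqA0 : m1 (A `&` [set 0]) = m2 (A `&` [set 0]).
  have [A0|A0] := pselect (A 0).
    have -> : A `&` [set 0] = [set 0].
      by apply/seteqP; split => y /=; [case|move=> ->].
    exact: eq0.
  have -> : A `&` [set 0] = set0.
    by apply/seteqP; split => y //= [Ay y0]; apply: A0; rewrite -y0.
  by rewrite !measure0.
have mI : measurable (A' `&` pos) by exact: measurableI.
rewrite AE !(measureU _ m5 (measurableU _ _ m3 m4) d2) !(measureU _ m3 m4 d1).
congr (_ + (_ + _))%E; [exact: eq_pos| |exact: eqA0].
by rewrite [LHS](sm1 _ mI) [RHS](sm2 _ mI); exact: eq_pos.
Qed.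

End symmetric_measures.

(** * Powers of 1 minus a Gaussian as approximate indicators of tails *)

Section bump.
Context {R : realType}.
Implicit Types (t z : R).

Lemma bernoulli_le z n : 0 <= z <= 1 -> 1 - n%:R * z <= (1 - z) ^+ n.
Proof.
move=> /andP[z0 z1]; elim: n => [|n IH]; first by rewrite mul0r subr0 expr0.
rewrite exprS -natr1 (@le_trans _ _ ((1 - z) * (1 - n%:R * z)))//.
  have h : 0 <= n%:R * z * z by rewrite !mulr_ge0.
  nra.
by apply: ler_wpM2l => //; lra.
Qed.

Let N n := (n.+1 * 2 ^ n.+1)%N.

(** The factor 2^n puts the threshold at ln 2: this product tends to 0 for t > ln 2 and to infinity
    for t <= ln 2. *)
Let NzE n t : (N n)%:R * expR (- (n.+1%:R * t)) =
  n.+1%:R * expR (- (n.+1%:R * (t - ln 2))).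
Proof.
rewrite /N natrM natrX -{1}(@lnK R 2) ?posrE// -expRM_natl -mulrA -expRD.
by congr (_ * expR _); ring.
Qed.

Lemma cvg_expRN_scale t : 0 < t -> expR (- (n.+1%:R * t)) @[n --> \oo] --> (0 : R).
Proof.
move=> t0; apply: (@squeeze_cvgr _ _ _ _ (fun _ => 0) (fun n => t^-1 * n.+1%:R^-1)).
- near=> n; rewrite expR_ge0/= -invfM [X in _ <= X^-1]mulrC expRN.
  have nt : 0 < n.+1%:R * t by rewrite mulr_gt0.
  by rewrite lef_pV2 ?posrE ?expR_gt0//; have := expR_ge1Dx (n.+1%:R * t); lra.
- exact: cvg_cst.
- rewrite -(mulr0 t^-1).
  by apply: cvgM; [exact: cvg_cst|exact: cvg_harmonic].
Unshelve. all: end_near. Qed.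

(* The exponent [n 2^n] (rather than [2^n]) makes the limit vanish also on the
   boundary [t = ln 2], so that atoms of the measure need no separate care. *)
Lemma cvg_bump t : 0 <= t ->
  (1 - expR (- (n.+1%:R * t))) ^+ (n.+1 * 2 ^ n.+1) @[n --> \oo] --> ((nat_of_bool (ln 2 < t)%R)%:R : R).
Proof.
move=> t0.
have z01 n : 0 <= expR (- (n.+1%:R * t)) <= 1.
  by rewrite expR_ge0/= -expR0 ler_expR oppr_le0 mulr_ge0.
have pow0 n : 0 <= (1 - expR (- (n.+1%:R * t))) ^+ N n.
  by apply: exprn_ge0; have := z01 n; lra.
have [tl|tl] := ltP (ln 2) t => /=.
  pose e := t - ln 2; have e0 : 0 < e by rewrite /e; lra.
  (* Bernoulli bounds the power below by 1 - m exp(-m e) with m = n + 1, and exp z >= z^2/2 gives m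
     exp(-m e) <= 2/(e^2 m). *)
  apply: (@squeeze_cvgr _ _ _ _ (fun n => 1 - 2 / e ^+ 2 * n.+1%:R^-1) (fun _ => 1)).
  - near=> n; apply/andP; split; last first.
      apply: exprn_ile1; have := z01 n; lra.
    apply: le_trans (bernoulli_le (N n) (z01 n)); rewrite lerD2l lerN2 NzE -/e.
    rewrite expRN ler_pdivrMr ?expR_gt0//.
    have n0 : 0 < n.+1%:R :> R by [].
    have := @expR_ge1Dxn R (n.+1%:R * e) 1 (ltac:(by rewrite mulr_ge0// ltW)).
    rewrite (_ : 2`! = 2%N)// => h.
    apply: (@le_trans _ _ (2 / e ^+ 2 / n.+1%:R * ((n.+1%:R * e) ^+ 2 / 2))).
      by rewrite le_eqVlt; apply/orP; left; apply/eqP; field; rewrite !gt_eqF.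
    apply: ler_wpM2l; first by rewrite !divr_ge0// sqr_ge0.
    by apply: le_trans h; lra.
  - rewrite -[X in _ --> X]subr0 -[X in _ - X](mulr0 (2 / e ^+ 2)).
    apply: cvgB; first exact: cvg_cst.
    by apply: cvgM; [exact: cvg_cst|exact: cvg_harmonic].
  - exact: cvg_cst.
(* Here 1 - z <= exp(-z) bounds the power by exp(-N z), and N z >= n + 1 because t <= ln 2. *)
apply: (@squeeze_cvgr _ _ _ _ (fun _ => 0) (fun n => expR (- (n.+1%:R * 1)))).
- near=> n; rewrite pow0/=.
  apply: (@le_trans _ _ (expR (- expR (- (n.+1%:R * t))) ^+ N n)).
    apply: lerXn2r; rewrite ?nnegrE ?expR_ge0//; first by have := z01 n; lra.
    by have := expR_ge1Dx (- expR (- (n.+1%:R * t))); lra.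
  rewrite -expRM_natl ler_expR mulrN lerN2 NzE.
  apply: (@le_trans _ _ (n.+1%:R * 1)); first by [].
  apply: ler_wpM2l => //; rewrite -[X in X <= _]expR0 ler_expR -mulrN opprB mulr_ge0//; lra.
- exact: cvg_cst.
- exact: cvg_expRN_scale.
Unshelve. all: end_near. Qed.

End bump.

Lemma Rintegral_indic d (T : measurableType d) (R : realType)
    (m : {measure set T -> \bar R}) (S : set T) (h : T -> R) :
  \int[m]_(y in S) h y = \int[m]_y (h y * \1_S y).
Proof.
rewrite Rintegral_mkcond; apply: eq_Rintegral => y _.
by rewrite patchE indicE; case: ifPn => _; rewrite ?mulr1 ?mulr0.
Qed.

(** * Recovering a symmetric law from its Gaussian means *)

Section gaussian_test_functions.
Context {R : realType}.
Local Notation mu := (@lebesgue_measure R).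
Variables (nu : probability R R) (f : R -> R) (C : R).
Hypothesis cf : continuous f.
Hypothesis fC : forall y, `|f y| <= C.
Hypothesis fN : forall y, f (- y) = f y.
Hypothesis nuN : forall A : set R, measurable A -> nu (-%R @^-1` A) = nu A.
Hypothesis nu_bell : forall b, 0 < b ->
  \int[nu]_y bell b y = \int[mu]_y (bell b y * f y).

Let mf : measurable_fun setT f.
Proof. exact: continuous_measurable_fun. Qed.

(** The powers tend to 1 at infinity, where [f] is only known to be bounded; the factor [bell c]
    restores integrability. *)
Let phi c b N (y : R) := bell c y * (1 - bell b y) ^+ N.

Let measurable_phi c b N : measurable_fun setT (phi c b N).
Proof. by apply: continuous_measurable_fun; rewrite /phi; contb. Qed.

Let phi_ge0 c b N y : 0 < b -> 0 <= phi c b N y.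
Proof.
by move=> b0; rewrite mulr_ge0 ?bell_ge0// exprn_ge0// subr_ge0 bell_le1// ltW.
Qed.

Let phi_le c b N y : 0 < b -> phi c b N y <= bell c y.
Proof.
move=> b0; rewrite ler_piMr ?bell_ge0//.
have h1 := bell_le1 y (ltW b0); have h2 := bell_ge0 b y.
by apply: exprn_ile1; lra.
Qed.

Let integrable_nu (h : R -> R) c : 0 < c -> measurable_fun setT h ->
  (forall y, `|h y| <= bell c y) -> nu.-integrable setT (EFin \o h).
Proof.
move=> c0 mh hc.
apply: (le_integrable _ _ _ (@finite_measure_integrable_cst _ _ R nu setT 1 measurableT)) => //.
  exact/measurable_EFinP.
move=> y _; by rewrite lee_fin /= normr1 (le_trans (hc y))// bell_le1// ltW.
Qed.

Let integrable_mu (h : R -> R) c : 0 < c -> measurable_fun setT h ->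
  (forall y, `|h y| <= bell c y) -> mu.-integrable setT (EFin \o (fun y => h y * f y)).
Proof.
move=> c0 mh hc.
have ib := integrableZl measurableT C (integrable_bell c0).
apply: (le_integrable _ _ _ ib) => //.
  by apply/measurable_EFinP; exact: measurable_funM.
move=> y _; rewrite lee_fin/= (le_trans _ (ler_norm _))//.
by rewrite normrM mulrC ler_pM.
Qed.

Let norm_phi c b N y : 0 < b -> `|phi c b N y| <= bell c y.
Proof. by move=> b0; rewrite ger0_norm ?phi_ge0// phi_le. Qed.

(** Since [bell c * bell b = bell (c + b)], the case N + 1 is the difference of the cases N at [c]
    and at [c + b]; hence the induction is over all [c]. *)
Let phi_test c b N : 0 < c -> 0 < b ->
  \int[nu]_y phi c b N y = \int[mu]_y (phi c b N y * f y).
Proof.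
move=> + b0; elim: N c => [|N IH] c c0.
  under eq_Rintegral do rewrite /phi expr0 mulr1.
  by under [RHS]eq_Rintegral do rewrite /phi expr0 mulr1; exact: nu_bell.
have cb0 : 0 < c + b by rewrite addr_gt0.
have phiS y : phi c b N.+1 y = phi c b N y - phi (c + b) b N y.
  by rewrite /phi bellD exprS; ring.
have i1 := integrable_nu c0 (measurable_phi c b N) (fun y => norm_phi c N y b0).
have i2 := integrable_nu cb0 (measurable_phi (c + b) b N) (fun y => norm_phi (c + b) N y b0).
have j1 := integrable_mu c0 (measurable_phi c b N) (fun y => norm_phi c N y b0).
have j2 := integrable_mu cb0 (measurable_phi (c + b) b N) (fun y => norm_phi (c + b) N y b0).
under eq_Rintegral do rewrite phiS.
under [RHS]eq_Rintegral do rewrite phiS mulrBl.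
by rewrite (RintegralB measurableT i1 i2) (RintegralB measurableT j1 j2) !IH.
Qed.

Let limit_test c (b_ : nat -> R) (N_ : nat -> nat) (S : set R) : 0 < c ->
  measurable S -> (forall n, 0 < b_ n) ->
  (forall y, (1 - bell (b_ n) y) ^+ N_ n @[n --> \oo] --> (\1_S y : R)) ->
  \int[nu]_(y in S) bell c y = \int[mu]_(y in S) (bell c y * f y).
Proof.
move=> c0 mS b0 lim.
have m1 : measurable_fun setT (\1_S : R -> R) by exact: measurable_indic.
have nuE := Rintegral_indic nu S (bell c).
have muE := Rintegral_indic mu S (fun y => bell c y * f y).
have l1 : \int[nu]_y phi c (b_ n) (N_ n) y @[n --> \oo] --> \int[nu]_y (bell c y * \1_S y).
  apply: (@Rdominated_cvg _ _ R nu setT (fun n => phi c (b_ n) (N_ n))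
    (fun y => bell c y * \1_S y) (bell c)) => //.
  - by apply: measurable_funM => //; exact: measurable_bell.
  - by apply: aeW => y _; apply: cvgM; [exact: cvg_cst|exact: lim].
  - apply: (integrable_nu c0 (measurable_bell c)) => y.
    by rewrite ger0_norm// bell_ge0.
  - by move=> n y _; exact: norm_phi.
have l2 : \int[mu]_y (phi c (b_ n) (N_ n) y * f y) @[n --> \oo] -->
    \int[mu]_y (bell c y * f y * \1_S y).
  apply: (@Rdominated_cvg _ _ R mu setT (fun n y => phi c (b_ n) (N_ n) y * f y)
    (fun y => bell c y * f y * \1_S y) (fun y => C * bell c y)) => //.
  - by move=> n; apply: measurable_funM => //; exact: measurable_phi.
  - apply: measurable_funM => //; apply: measurable_funM => //.
    exact: measurable_bell.
  - apply: aeW => y _; rewrite mulrAC; apply: cvgM; last exact: cvg_cst.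
    by apply: cvgM; [exact: cvg_cst|exact: lim].
  - exact: (integrableZl measurableT C (integrable_bell c0)).
  - by move=> n y _; rewrite normrM mulrC ler_pM// norm_phi.
rewrite (funext (fun n => phi_test (N_ n) c0 (b0 n))) in l1.
rewrite nuE muE -(cvg_lim (@Rhausdorff R) l1).
by rewrite (cvg_lim (@Rhausdorff R) l2).
Qed.

Let tail_set (a : R) : set R := [set y | a < `|y|].

Let measurable_tail a : measurable (tail_set a).
Proof.
rewrite -[X in measurable X]setTI.
have mn : measurable_fun setT (Num.norm : R -> R).
  by apply: continuous_measurable_fun; exact: norm_continuous.
have -> : tail_set a = Num.norm @^-1` `]a, +oo[.
  by apply/seteqP; split => y; rewrite /tail_set/= in_itv/= andbT.
exact: mn.
Qed.

Let tail_test c a : 0 < c -> 0 <= a ->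
  \int[nu]_(y in tail_set a) bell c y = \int[mu]_(y in tail_set a) (bell c y * f y).
Proof.
move=> c0; rewrite le_eqVlt => /predU1P[<-|a0].
  (* For a = 0 the set is the complement of {0}, and one factor suffices: 1 - [bell n.+1%:R y] tends
     to 1 exactly off 0. *)
  apply: (@limit_test c (fun n => n.+1%:R) (fun _ => 1%N)) => // y.
  rewrite /tail_set indicE; have [->|y0] := eqVneq y 0.
    rewrite (_ : (0 \in _) = false); last first.
      by apply/negbTE; rewrite notin_setE/= normr0 ltxx.
    by under eq_fun do rewrite bell_at0 subrr expr1; exact: cvg_cst.
  rewrite mem_set /=; last by rewrite normr_gt0.
  under eq_fun do rewrite expr1.
  suff h : bell n.+1%:R y @[n --> \oo] --> 0.
    by have := cvgB (@cvg_cst _ (1 : R) _ \oo _) h; rewrite subr0; exact.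
  have y20 : 0 < y ^+ 2 by rewrite exprn_even_gt0.
  have y2 : 0 < y ^+ 2 / 2 by rewrite divr_gt0.
  rewrite (_ : (fun n => _) = (fun n => expR (- (n.+1%:R * (y ^+ 2 / 2))))).
    exact: cvg_expRN_scale.
  by apply/funext => n; rewrite /bell mulrA.
have l2 : 0 < ln 2 :> R by rewrite ln_gt0// ltr1n.
(* With this [b], the condition b y^2/2 > ln 2 of [cvg_bump] reads |y| > a. *)
pose b := 2 * ln 2 / a ^+ 2.
have b0 : 0 < b by rewrite /b divr_gt0 ?mulr_gt0// exprn_gt0.
apply: (@limit_test c (fun n => b * n.+1%:R) (fun n => (n.+1 * 2 ^ n.+1)%N)) => // [n|y].
  by rewrite mulr_gt0.
pose t := b * y ^+ 2 / 2.
have t0 : 0 <= t by rewrite /t divr_ge0// mulr_ge0 ?sqr_ge0// ltW.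
have -> : \1_(tail_set a) y = (nat_of_bool (ln 2 < t)%R)%:R :> R.
  rewrite indicE; congr (nat_of_bool _)%:R.
  have -> : t = ln 2 * (`|y| / a) ^+ 2.
    by rewrite exprMn real_normK ?num_real// /t /b; field; rewrite gt_eqF.
  rewrite -[X in X < _]mulr1 ltr_pM2l// -[X in X < _](expr1n _ 2).
  rewrite ltr_pXn2r ?nnegrE//; last by rewrite divr_ge0// ltW.
  rewrite ltr_pdivlMr// mul1r.
  by apply/idP/idP => [/set_mem//|ay]; exact: mem_set.
have := cvg_bump t0.
by apply: cvg_trans; apply: near_eq_cvg; apply: nearW => n /=; congr ((1 - _) ^+ _);
  rewrite /bell /t; congr expR; ring.
Qed.

(** If f(y) < 0, then by continuity and evenness f is negative on a shell p < |z| <= q. Subtracting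
    the tail identities at p and q equates a nonnegative [nu]-integral over the shell with a
    negative Lebesgue integral. *)
Lemma gaussian_test_ge0 y : 0 <= f y.
Proof.
rewrite leNgt; apply/negP => fy0.
pose y1 : R := `|y|.
have fy1 : f y1 = f y by rewrite /y1; case: (ler0P y) => // _; rewrite fN.
have y10 : 0 <= y1 by exact: normr_ge0.
have [e e0 he] : exists2 e, 0 < e & forall z, `|z - y1| < e -> f z <= f y / 2.
  have e0 : 0 < - f y / 2 by lra.
  have := @cf y1; move/cvgrPdist_lt => /(_ _ e0) /nbhs_ballP[e /= e0' he].
  exists e => // z zy; have := he z; rewrite /ball/= distrC => /(_ zy).
  by rewrite fy1 ltr_norml => /andP[h1 h2]; lra.
(* The shell is taken just beyond |y|, so that both radii are positive even when y = 0. *)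
pose p : R := y1 + e / 3; pose q : R := y1 + e / 2.
have p0 : 0 <= p by rewrite /p; lra.
have q0 : 0 <= q by rewrite /q; lra.
have pq : p < q by rewrite /p /q; lra.
have negf (z : R) : p < `|z| -> `|z| <= q -> f z <= f y / 2.
  move=> pz zq; have -> : f z = f `|z| by case: (ler0P z) => // _; rewrite fN.
  by apply: he; rewrite ltr_norml; apply/andP; split; rewrite /p /q in pz zq; lra.
have sub : tail_set q `<=` tail_set p by move=> z /=; rewrite /tail_set/=; lra.
pose S := tail_set p `\` tail_set q.
have mS : measurable S by exact: measurableD.
have mSmu : measurable (S : set (measurableTypeR R)) by exact: mS.
have mqmu : measurable (tail_set q : set (measurableTypeR R)) by exact: measurable_tail.
have pE : tail_set p = tail_set q `|` S.
  by rewrite /S setUDr setDv setD0 setUC; apply/esym/setUidl.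
have disj : [disjoint tail_set q & S].
  by apply/disj_setPS => z [] /= zq [].
have c0 : (0 : R) < 1 by [].
have i1 := @integrable_nu (bell 1) 1 c0 (measurable_bell 1)
  (fun y => eq_ind_r (fun z => z <= bell 1 y) (lexx _) (ger0_norm (bell_ge0 1 y))).
have i2 := @integrable_mu (bell 1) 1 c0 (measurable_bell 1)
  (fun y => eq_ind_r (fun z => z <= bell 1 y) (lexx _) (ger0_norm (bell_ge0 1 y))).
have := tail_test c0 p0; rewrite pE.
rewrite (Rintegral_setU (measurable_tail q) mS (integrableS measurableT (measurableU _ _ (measurable_tail q) mS) (@subsetT _ _) i1) disj).
rewrite (Rintegral_setU mqmu mSmu (integrableS measurableT (measurableU _ _ mqmu mSmu) (@subsetT _ _) i2) disj) (tail_test c0 q0).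
move=> /addrI h.
have : 0 <= \int[nu]_(z in S) bell 1 z by apply: Rintegral_ge0 => z _; exact: bell_ge0.
rewrite h.
(* On the shell [f] is at most [f y / 2], which is negative, and [bell 1] is at least [bell 1 q], so
   [k] bounds the integrand above; keeping [k] on ]p, q] only is still an upper bound. *)
pose k := f y / 2 * bell 1 q.
have k0 : k < 0 by rewrite /k nmulr_rlt0 ?bell_gt0//; lra.
have : \int[mu]_(z in S) (bell 1 z * f z) <= \int[mu]_(z in S) (k * \1_(`]p, q] : set R) z).
  apply: le_Rintegral => //.
  - by apply: integrableS i2.
  - apply: (integrableS measurableT) => //.
    by exact: (integrableZl measurableT k (integrable_indic_itv _ _ _ _)).
  - move=> z [pz]; rewrite /tail_set/= => /negP; rewrite -leNgt => zq.
    have fz := negf z pz zq.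
    have bz : bell 1 q <= bell 1 z.
      rewrite /bell ler_expR lerN2 !mul1r ler_pM2r//.
      by rewrite -[z ^+ 2]real_normK ?num_real// ler_sqr ?nnegrE.
    have b1 := bell_gt0 1 z; have b2 := bell_gt0 1 q.
    apply: (@le_trans _ _ k); first by rewrite /k; nra.
    by rewrite indicE; case: (z \in _) => /=; lra.
suff -> : \int[mu]_(z in S) (k * \1_(`]p, q] : set R) z) = k * (q - p).
  have kpq : k * (q - p) < 0 by rewrite nmulr_rlt0// subr_gt0.
  by move=> h1 h2; move: (le_lt_trans (le_trans h2 h1) kpq); rewrite ltxx.
rewrite Rintegral_mkcond.
transitivity (\int[mu]_z (k * \1_(`]p, q] : set R) z)).
  apply: eq_Rintegral => z _; rewrite patchE; case: ifPn => // zS.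
  rewrite indicE memNset ?mulr0//= in_itv/= => /andP[pz zq].
  move: zS; rewrite notin_setE; apply; rewrite /S /tail_set/=.
  have z0 : 0 < z by lra.
  by rewrite gtr0_norm//; split => //; lra.
rewrite RintegralZl//; last exact: integrable_indic_itv.
congr (_ * _).
rewrite /Rintegral integral_indic// setIT.
have /= := @lebesgue_measure_itv R (Interval (BRight p) (BRight q)).
by rewrite lte_fin pq => /(congr1 fine).
Qed.

(** As c decreases to 0, [bell c] increases to 1. Now that f >= 0, monotone convergence removes the
    weight without any prior integrability of f. *)
Let unweight (S : set R) : measurable S ->
  (forall c, 0 < c -> \int[nu]_(y in S) bell c y = \int[mu]_(y in S) (bell c y * f y)) ->
  nu S = density f S.
Proof.
move=> mS test; pose c_ (n : nat) : R := n.+1%:R^-1.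
have c0 n : 0 < c_ n by rewrite invr_gt0.
have f0 := gaussian_test_ge0.
have bellc y : (bell (c_ n) y : R) @[n --> \oo] --> (1 : R).
  rewrite -(bell0 y); apply: (cvg_comp c_ (fun c => bell c y) cvg_harmonic).
  have : continuous (fun c => bell c y) by rewrite /bell; cont.
  exact.
have bell_nd y : {homo (fun n => bell (c_ n) y) : n m / (n <= m)%N >-> n <= m}.
  move=> n m nm; rewrite /bell ler_expR lerN2 ler_pM2r// ler_wpM2r ?sqr_ge0//.
  by rewrite lef_pV2 ?posrE// ler_nat.
have l1 := @cvg_monotone_convergence _ _ R nu S mS (fun n y => (bell (c_ n) y)%:E) _ _ _.
have l2 := @cvg_monotone_convergence _ _ R mu S mS (fun n y => (bell (c_ n) y * f y)%:E) _ _ _.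
have mS' : measurable (S : set (measurableTypeR R)) by exact: mS.
have E n : (\int[nu]_(y in S) (bell (c_ n) y)%:E = \int[mu]_(y in S) (bell (c_ n) y * f y)%:E)%E.
  have nb y : `|bell (c_ n) y| <= bell (c_ n) y by rewrite ger0_norm ?bell_ge0.
  have i1 := integrableS measurableT mS (@subsetT _ _) (integrable_nu (c0 n) (measurable_bell _) nb).
  have i2 : mu.-integrable S (EFin \o (fun y => bell (c_ n) y * f y)).
    by apply: integrableS (integrable_mu (c0 n) (measurable_bell _) nb).
  have f1 := integrable_fin_num mS i1; have f2 := integrable_fin_num mS' i2.
  have := congr1 EFin (test _ (c0 n)); rewrite /Rintegral.
  by move=> h; apply: etrans (etrans h (fineK f2)); apply/esym; exact: fineK f1.
have L1 : (\int[nu]_(y in S) limn (fun n => (bell (c_ n) y)%:E) = nu S)%E.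
  rewrite -[RHS]mul1e -integral_cst//; apply: eq_integral => y _.
  by apply/cvg_lim => //; apply: cvg_EFin; [exact: nearW|exact: bellc].
have L2 : (\int[mu]_(y in S) limn (fun n => (bell (c_ n) y * f y)%:E) = density f S)%E.
  apply: eq_integral => y _.
  apply/cvg_lim => //; apply: cvg_EFin; first exact: nearW.
  by rewrite -[X in _ --> X]mul1r; apply: cvgM; [exact: bellc|exact: cvg_cst].
rewrite -L1 -L2.
have {}l1 := l1 _ _ _; have {}l2 := l2 _ _ _.
apply: (@cvg_unique _ (@ereal_hausdorff R) (\int[nu]_(y in S) (bell (c_ n) y)%:E @[n --> \oo])%E).
  apply: l1.
  - by move=> n; apply/measurable_EFinP/measurable_funTS; exact: measurable_bell.
  - by move=> n y _; rewrite lee_fin bell_ge0.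
  - by move=> y _ n m nm; rewrite lee_fin; exact: bell_nd.
rewrite (funext E); apply: l2.
- move=> n; apply/measurable_EFinP/measurable_funTS/measurable_funM => //.
  exact: measurable_bell.
- by move=> n y _; rewrite lee_fin mulr_ge0 ?bell_ge0.
- by move=> y _ n m nm; rewrite lee_fin ler_wpM2r// bell_nd.
Qed.

Lemma gaussian_test_density A : measurable A -> nu A = density f A.
Proof.
move=> mA; have f0 := gaussian_test_ge0.
pose dens := density f : {measure set R -> \bar R}.
(* On the whole line the required test is [nu_bell] itself; this shows that [f] has integral 1. *)
have nuT : nu setT = density f setT by apply: unweight.
have nufin : (nu setT < +oo)%E by rewrite probability_setT ltry.
apply: (symmetric_measure_unique (m1 := nu) (m2 := dens f0 mf)) => //.
  move=> B mB; rewrite /= /density.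
  rewrite integral_mkcond [RHS]integral_mkcond.
  rewrite [RHS](ge0_integral_affine (a := -1) 0).
  - rewrite normrN1 mul1e; apply: eq_integral => y _.
    by rewrite !patchE addr0 mulN1r fN.
  - by rewrite oppr_eq0 oner_neq0.
  - have h := measurable_restrictT (EFin \o f) mB.
    by apply/h; apply/measurable_EFinP; exact: measurable_funTS.
  - by move=> y; rewrite patchE; case: ifPn => // _; rewrite lee_fin.
move=> x x0; apply: unweight; first exact: measurable_tail.
by move=> c c0; exact: tail_test.
Qed.

End gaussian_test_functions.

(** * The distribution of the inverse of k *)

Section layer_cake.
Context {R : realType}.
Local Notation mu := (@lebesgue_measure R).
Implicit Types (b x t : R).

(** On the positive half-line this is minus the derivative of [bell b]; the norm keeps it
    nonnegative everywhere, for Tonelli. *)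
Definition wbell b t := b * `|t| * bell b t.

Lemma wbell_ge0 b t : 0 < b -> 0 <= wbell b t.
Proof. by move=> b0; rewrite /wbell !mulr_ge0// ?bell_ge0// ltW. Qed.

Lemma continuous_wbell b : continuous (wbell b).
Proof. by rewrite /wbell; contb. Qed.

Lemma measurable_wbell b : measurable_fun setT (wbell b).
Proof. by apply: continuous_measurable_fun; exact: continuous_wbell. Qed.

(** The indicator of x < t, encoded through the difference so that joint measurability follows by
    composition. *)
Definition above t x : R := \1_(`]0, +oo[%classic : set R) (t - x).

Lemma aboveE t x : above t x = (x < t)%R%:R.
Proof.
rewrite /above indicE; congr (nat_of_bool _)%:R.
by rewrite mem_setE in_itv/= andbT subr_gt0.
Qed.

Lemma above_ge0 t x : 0 <= above t x. Proof. by rewrite aboveE. Qed.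

Lemma measurable_above d (T : measurableType d) (p q : T -> R) :
  measurable_fun setT p -> measurable_fun setT q ->
  measurable_fun setT (fun z => above (p z) (q z)).
Proof.
move=> mp mq; have mi : measurable_fun setT (\1_(`]0, +oo[%classic : set R) : R -> R).
  exact: measurable_indic.
by apply: (measurableT_comp mi); apply: measurable_funB.
Qed.

Lemma integral_wbell_above b x : 0 < b -> 0 <= x ->
  (\int[mu]_(t in `]0%R, +oo[) (wbell b t * above t x)%:E = (bell b x)%:E)%E.
Proof.
move=> b0 x0.
transitivity (\int[mu]_(t in `]x, +oo[) (wbell b t)%:E)%E.
  rewrite [LHS]integral_mkcond [RHS]integral_mkcond; apply: eq_integral => t _.
  rewrite !patchE !mem_setE !in_itv/= !andbT aboveE.
  have [xt|tx] := ltP x t; first by rewrite (le_lt_trans x0 xt) mulr1.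
  by case: ifP => // _; rewrite mulr0.
rewrite integral_itv_obnd_cbnd; last first.
  by apply/measurable_EFinP/measurable_funTS; exact: measurable_wbell.
have dF (t : R) : is_derive t 1 (fun t => - bell b t) (b * t * bell b t).
  have := is_deriveN (is_derive1_bell b t).
  by rewrite mulNr opprK.
rewrite (@ge0_continuous_FTC2y _ (wbell b) (fun t => - bell b t) x 0).
- by rewrite EFinN oppeK add0e.
- by move=> t _; exact: wbell_ge0.
- by apply: continuous_subspaceT; exact: continuous_wbell.
- by rewrite -oppr0; apply: cvgN; exact: cvg_bell_pinfty.
- by move=> t _; case: (dF t).
- apply: cvg_at_right_filter; have : continuous (fun t => - bell b t) by contb.
  exact.
- move=> t; rewrite in_itv/= andbT => xt.
  rewrite derive1E; have [_ ->] := dF t.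
  by rewrite /wbell gtr0_norm// (le_lt_trans x0 xt).
Qed.

Lemma Rintegral_wbell_above b x : 0 < b -> 0 <= x ->
  \int[mu]_(t in `]0, +oo[) (wbell b t * above t x) = bell b x.
Proof. by move=> b0 x0; rewrite /Rintegral integral_wbell_above. Qed.

Lemma integrable_wbell b : 0 < b -> mu.-integrable `]0, +oo[ (EFin \o wbell b).
Proof.
move=> b0; apply: (integrableS measurableT) => //.
apply: eq_integrable (integrableZl measurableT b (integrable_mul_bell b0)) => // t _.
by rewrite /wbell/= -EFinM mulrA.
Qed.

(** On x < t, half of the Gaussian in t is traded for a Gaussian in x; the result is a product
    bound, as [Rfubini] demands. *)
Lemma wbell_above_le b t x : 0 < b -> 0 <= x ->
  wbell b t * above t x <= bell (b / 2) x * (2 * wbell (b / 2) t).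
Proof.
move=> b0 x0; have b20 : 0 < b / 2 by rewrite divr_gt0.
have w0 := wbell_ge0 t b20.
rewrite aboveE; have [xt|_] := ltP x t; last first.
  by rewrite mulr0 mulr_ge0 ?bell_ge0// mulr_ge0.
rewrite mulr1.
have -> : wbell b t = bell (b / 2) t * (2 * wbell (b / 2) t).
  rewrite /wbell [in bell b t](splitr b) bellD.
  by field.
apply: ler_wpM2r; first by rewrite mulr_ge0.
rewrite /bell ler_expR lerN2 ler_pM2r// ler_pM2l// ler_sqr ?nnegrE// ltW//.
exact: le_lt_trans xt.
Qed.

End layer_cake.

(** * The Hankel transform of psi paired with Gaussians *)

Section hankel.
Context {R : realType}.
Local Notation mu := (@lebesgue_measure R).
Variable psi : R -> R.
Hypothesis cpsi : continuous psi.
Hypothesis psi_ge0 : forall x, 0 <= psi x.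
Hypothesis ipsi : mu.-integrable `]0, +oo[ (fun r => (r * psi r)%:E).

Let H := hankel0 psi.

Let mpsi : measurable_fun setT psi.
Proof. exact: continuous_measurable_fun. Qed.

Let norm_hankel_fun (r z : R) : 0 < r -> `|psi r * besselJ0 z * r| <= r * psi r.
Proof.
move=> r0; rewrite !normrM (ger0_norm (psi_ge0 r)) (gtr0_norm r0).
rewrite mulrAC (mulrC (psi r)) ler_piMr ?le_norm_besselJ0//.
by rewrite mulr_ge0// ltW.
Qed.

Let integrable_hankel t :
  mu.-integrable `]0, +oo[ (fun r => (psi r * besselJ0 (r * t) * r)%:E).
Proof.
apply: (le_integrable _ _ _ ipsi) => //.
  apply/measurable_EFinP/measurable_funTS; apply: measurable_funM => //.
  by apply: measurable_funM => //; apply: (measurableT_comp measurable_besselJ0); meas.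
move=> r /=; rewrite in_itv/= andbT => r0; rewrite lee_fin.
by rewrite (le_trans (norm_hankel_fun _ r0))// ler_norm.
Qed.

Lemma continuous_hankel0 : continuous (hankel0 psi).
Proof.
move=> z; have zI : z \in `]z - 1, z + 1[%classic by rewrite inE/= in_itv/=; lra.
apply: (@continuity_under_integral _ _ _ mu (fun t r => psi r * besselJ0 (r * t) * r) `]0, +oo[ _
  (z - 1) (z + 1) _ _ (fun r => r * psi r)) => //.
- by move=> u _; exact: integrable_hankel.
- apply: aeW => r _ u _.
  have : continuous (fun t => psi r * besselJ0 (r * t) * r).
    apply: contM; last by cont.
    apply: contM; first by cont.
    apply: (@continuous_comp1 _ (fun t => r * t)); first by cont.
    exact: continuous_besselJ0.
  exact.
- by move=> u _; apply: aeW => r /=; rewrite in_itv/= andbT => r0; exact: norm_hankel_fun.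
Qed.

Lemma norm_hankel0_le t : `|hankel0 psi t| <= \int[mu]_(r in `]0, +oo[) (r * psi r).
Proof.
rewrite /hankel0 (le_trans (le_normr_Rintegral _ (integrable_hankel t)))//.
apply: le_Rintegral => //.
- exact: integrable_abse (integrable_hankel t).
- by move=> r /=; rewrite in_itv/= andbT => r0; exact: norm_hankel_fun.
Qed.

Let cmulH : continuous (fun u : R => u * H u).
Proof. by apply: contM; [cont|exact: continuous_hankel0]. Qed.

Lemma kfun_primitive : exists2 P, forall x : R, is_derive x 1 P (x * hankel0 psi x) &
  forall t, 0 <= t -> kfun psi t = 1 - (P t - P 0).
Proof.
have [P dP] := continuous_primitive cmulH.
by exists P => // t t0; rewrite /kfun (Rintegral_FTC cmulH dP t0).
Qed.

(** The transform is moved from [psi] to the Gaussian, where Weber's formula evaluates it. As |J_0|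
    <= 1, the product of [x * bell b x] and [r * psi r] dominates. *)
Lemma Rintegral_mul_hankel0_bell b : 0 < b ->
  \int[mu]_(x in `]0, +oo[) (x * hankel0 psi x * bell b x) =
  b^-1 * \int[mu]_(r in `]0, +oo[) (r * psi r * bell b^-1 r).
Proof.
move=> b0; pose F (z : R * R) := z.2 * psi z.2 * (z.1 * bell b z.1 * besselJ0 (z.2 * z.1)).
have mF : measurable_fun setT F.
  have m1 : measurable_fun setT (fun z : R * R => psi z.2) by exact: measurableT_comp.
  have m2 : measurable_fun setT (fun z : R * R => bell b z.1).
    exact: measurableT_comp (measurable_bell b) _.
  have m3 : measurable_fun setT (fun z : R * R => besselJ0 (z.2 * z.1)).
    by apply: (measurableT_comp measurable_besselJ0); meas.
  by rewrite /F; meas.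
transitivity (\int[mu]_(x in `]0, +oo[) \int[mu]_(r in `]0, +oo[) F (x, r)).
  apply: eq_Rintegral => x _.
  rewrite /hankel0 mulrAC -RintegralZl//; last exact: integrable_hankel.
  by apply: eq_Rintegral => r _; rewrite /F/=; ring.
rewrite (@Rfubini _ _ _ _ R mu mu `]0, +oo[ `]0, +oo[ _ _ F
  (fun x => x * bell b x) (fun r => r * psi r) mF)//; last 2 first.
- exact: integrable_mul_bell_half.
- move=> x r /=; rewrite !in_itv/= !andbT => x0 r0; rewrite /F/=.
  have n1 : 0 <= r * psi r by rewrite mulr_ge0// ltW.
  have n2 : 0 <= x * bell b x by rewrite mulr_ge0// ?bell_ge0// ltW.
  rewrite !normrM -[`|r| * _]normrM -[`|x| * _]normrM (ger0_norm n1) (ger0_norm n2) mulrC.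
  by apply: ler_wpM2r => //; rewrite ler_piMr// le_norm_besselJ0.
have ib : mu.-integrable `]0, +oo[ (fun r => (r * psi r * bell b^-1 r)%:E).
  apply: (le_integrable _ _ _ ipsi) => //.
    apply/measurable_EFinP/measurable_funTS/measurable_funM; first by apply: measurable_funM.
    exact: measurable_bell.
  move=> r _; rewrite lee_fin/= normrM ler_piMr// ger0_norm ?bell_ge0// bell_le1//.
  by rewrite invr_ge0 ltW.
rewrite -RintegralZl//; apply: eq_Rintegral => r _.
transitivity (r * psi r * (b^-1 * bell b^-1 r)); last by ring.
rewrite -(weber r b0) -RintegralZl//; exact: integrable_weber.
Qed.

End hankel.

(** * Monotonicity of k and the law of its inverse at a uniform variable *)

Section inverse_cdf.
Context {R : realType}.
Local Notation mu := (@lebesgue_measure R).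
Variable psi : R -> R.
Hypothesis cpsi : continuous psi.
Hypothesis psi_ge0 : forall x, 0 <= psi x.
Hypothesis ipsi : mu.-integrable `]0, +oo[ (fun r => (r * psi r)%:E).
Hypothesis k_bij : set_bij `]0, +oo[ `]0, 1[ (kfun psi).

Let k := kfun psi.
Let K := kinv psi.
Let I01 : set R := `]0, 1[%classic.

Let k01 (x : R) : 0 < x -> 0 < k x < 1.
Proof.
move=> x0; case: k_bij => kf _ _.
by have /= := kf x; rewrite !in_itv/= andbT => /(_ x0).
Qed.

(** A continuous injection on an interval is monotone. Adding the point 0, where k = 1 lies outside
    ]0, 1[, keeps injectivity and fixes the direction, because k(1) < 1. *)
Lemma kfun_mono x y : 0 < x -> 0 < y -> (kfun psi x <= kfun psi y) = (y <= x).
Proof.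
have [P dP kP] := kfun_primitive cpsi psi_ge0 ipsi.
pose kk (t : R) := 1 - (P t - P 0).
have ckk : continuous kk.
  have cP := is_derive1_continuous dP; rewrite /kk.
  by apply: contD; [cont|apply: contN; cont].
have kk0 : kk 0 = 1 by rewrite /kk subrr subr0.
have kkE t : 0 < t -> kk t = k t by move=> t0; rewrite /k kP// ltW.
have kk_inj : {in `[0, +oo[ &, injective kk}.
  move=> s t; rewrite !in_itv/= !andbT !le_eqVlt.
  move=> /predU1P[<-|s0] /predU1P[<-|t0] //.
  - by rewrite kk0 kkE// => k1; have := k01 t0; rewrite -k1 ltxx andbF.
  - by rewrite kk0 kkE// => k1; have := k01 s0; rewrite k1 ltxx andbF.
  by rewrite !kkE// => kst; apply: (set_bij_inj k_bij) kst; rewrite inE/= in_itv/= andbT.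
move=> x0 y0; rewrite -[kfun psi x]kkE// -[kfun psi y]kkE//.
apply: (@itv_continuous_inj_ge _ kk `[0, +oo[) => //; last 2 first.
- by rewrite in_itv/= andbT ltW.
- by rewrite in_itv/= andbT ltW.
- exists 0, 1; split; rewrite ?in_itv/= ?lexx ?ler01//.
  by rewrite kk0 kkE// ltW//; have := @k01 1 ltr01; case/andP.
- exact: continuous_subspaceT.
Qed.

Let kinvE u : I01 u -> 0 < K u /\ k (K u) = u.
Proof.
move=> u01; have [[Kf _ _] _ kK _] := kinvP k_bij.
split; last by apply: kK; exact: mem_set.
by have := Kf u u01; rewrite /= in_itv/= andbT.
Qed.

Lemma kinv_lt u t : I01 u -> 0 < t -> (kinv psi u < t) = (kfun psi t < u).
Proof.
move=> u01 t0; have [Ku0 kKu] := kinvE u01.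
by rewrite -[in RHS]kKu !ltNge kfun_mono.
Qed.

Lemma kinv_gt u t : I01 u -> 0 < t -> (t < kinv psi u) = (u < kfun psi t).
Proof.
move=> u01 t0; have [Ku0 kKu] := kinvE u01.
by rewrite -[in RHS]kKu !ltNge kfun_mono.
Qed.

Lemma continuous_kinv : {in I01, continuous (kinv psi)}.
Proof.
move=> u /set_mem u01; have [Ku0 kKu] := kinvE u01.
apply/cvgrPdist_lt => e e0; rewrite -/K.
have a0 : 0 < K u + e by lra.
have ku : k (K u + e) < u by rewrite -kinv_lt// -/K; lra.
have near1 : \forall v \near u, I01 v.
  move: u01; rewrite /I01 /= in_itv/= => /andP[u0 u1].
  by near=> v; rewrite /= in_itv/=; apply/andP; split; near: v; [exact: lt_nbhsr|exact: lt_nbhsl].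
have near2 : \forall v \near u, k (K u + e) < v by exact: lt_nbhsr.
(* If K(u) <= e, the lower bound K(u) - e < K(v) is just positivity of K(v); otherwise K(u) - e is
   positive and [kinv_gt] applies to it. *)
have [Kue|Kue] := leP (K u) e.
  near=> v; have v01 : I01 v by near: v.
  have h : K v < K u + e by rewrite kinv_lt//; near: v.
  by have [Kv0 _] := kinvE v01; rewrite ltr_distlC; apply/andP; split; lra.
have near3 : \forall v \near u, v < k (K u - e).
  by apply: lt_nbhsl; rewrite -kinv_gt// -/K; lra.
near=> v; have v01 : I01 v by near: v.
have h : K v < K u + e by rewrite kinv_lt//; near: v.
have h2 : K u - e < K v by rewrite kinv_gt//; [near: v|lra].
by rewrite ltr_distlC; apply/andP; split; lra.
Unshelve. all: end_near. Qed.

Lemma measurable_kinv : measurable_fun setT (kinv psi).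
Proof.
have m01 : measurable_fun I01 (kinv psi).
  apply: open_continuous_measurable_fun; first exact: interval_open.
  exact: continuous_kinv.
have [_ _ _ out] := kinvP k_bij.
(* The default value 0 makes [kinv psi] equal to its own restriction to ]0, 1[. *)
rewrite (_ : kinv psi = kinv psi \_ I01).
  by have h := measurable_restrictT (kinv psi) (@measurable_itv R `]0, 1[); apply/h.
by apply/funext => u; rewrite patchE; case: ifPn => // /out.
Qed.

(** As k decreases, K(u) < t means u > k(t): thus 1 - k is the distribution function of K(U). *)
Lemma integral_kinv_above t : 0 < t ->
  (\int[mu]_(u in `]0%R, 1%R[) (above t (kinv psi u))%:E = (1 - kfun psi t)%:E)%E.
Proof.
move=> t0; have /andP[kt0 kt1] := k01 t0.
transitivity (\int[mu]_(u in `]0%R, 1%R[) (\1_(`]kfun psi t, 1[%classic : set R) u)%:E)%E.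
  apply: eq_integral => u /set_mem u01.
  rewrite aboveE kinv_lt// indicE mem_setE in_itv/=.
  by move: u01; rewrite /= in_itv/= => /andP[_ ->]; rewrite andbT.
rewrite integral_indic//.
rewrite setIidl; last first.
  move=> u /=; rewrite !in_itv/= => /andP[ku ->]; rewrite andbT.
  exact: lt_trans ku.
have := @lebesgue_measure_itv R (Interval (BRight (kfun psi t)) (BLeft 1)).
by rewrite /= lte_fin kt1 -EFinB.
Qed.

(** Formally K(U) has density x H_0(psi)(x). Writing [bell b] as an integral of its tails brings in
    the distribution function 1 - k, itself the integral of that density; exchanging the integrals
    recombines the tails into [bell b x]. *)
Lemma integral_bell_kinv b : 0 < b ->
  (\int[mu]_(u in `]0%R, 1%R[) (bell b (kinv psi u))%:E =
   (b^-1 * \int[mu]_(r in `]0, +oo[) (r * psi r * bell b^-1 r))%:E)%E.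
Proof.
move=> b0; have b20 : 0 < b / 2 by rewrite divr_gt0.
have mw : measurable_fun setT (wbell b) := measurable_wbell b.
have mK := measurable_kinv.
pose F (z : R * R) := (wbell b z.2 * above z.2 (kinv psi z.1))%:E.
have mF : measurable_fun setT F.
  apply/measurable_EFinP/measurable_funM.
    exact: measurableT_comp (measurable_wbell b) _.
  by apply: measurable_above => //; exact: measurableT_comp mK _.
transitivity (\int[mu]_(u in `]0%R, 1%R[) \int[mu]_(t in `]0%R, +oo[) F (u, t))%E.
  apply: eq_integral => u /set_mem u01; have [Ku0 _] := kinvE u01.
  by rewrite -(integral_wbell_above b0 (ltW Ku0)).
have m0y : measurable (`]0, +oo[%classic : set (measurableTypeR R)) by [].
have m01 : measurable (`]0, 1[%classic : set (measurableTypeR R)) by [].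
rewrite (tonelli mu mu m01 m0y mF)//; last first.
  by move=> z; rewrite lee_fin mulr_ge0 ?above_ge0// wbell_ge0.
(* [G] contains the Hankel transform, whose sign is left open here, so it is exchanged by domination
   ([GM]) instead of Tonelli. *)
pose G (z : R * R) := z.2 * hankel0 psi z.2 * (wbell b z.1 * above z.1 z.2).
have cH := continuous_hankel0 cpsi psi_ge0 ipsi.
have mG : measurable_fun setT G.
  have m1 : measurable_fun setT (fun z : R * R => hankel0 psi z.2).
    by apply: measurableT_comp => //; exact: continuous_measurable_fun.
  have m2 : measurable_fun setT (fun z : R * R => wbell b z.1).
    exact: measurableT_comp (measurable_wbell b) _.
  have m3 : measurable_fun setT (fun z : R * R => above z.1 z.2).
    exact: measurable_above.
  by rewrite /G; meas.
pose M := \int[mu]_(r in `]0, +oo[) (r * psi r).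
have M0 : 0 <= M.
  apply: Rintegral_ge0 => r /=; rewrite in_itv/= andbT => r0.
  by rewrite mulr_ge0// ltW.
have GM t x : `]0, +oo[%classic t -> `]0, +oo[%classic x ->
    `|G (t, x)| <= (2 * wbell (b / 2) t) * (M * (x * bell (b / 2) x)).
  rewrite /= !in_itv/= !andbT => t0 x0; rewrite /G/= normrM [`|x * _|]normrM (gtr0_norm x0).
  have wa0 : 0 <= wbell b t * above t x by rewrite mulr_ge0 ?above_ge0// wbell_ge0.
  rewrite (ger0_norm wa0).
  have h1 := norm_hankel0_le cpsi psi_ge0 ipsi x.
  have h2 := wbell_above_le t b0 (ltW x0).
  rewrite (_ : (2 * wbell (b / 2) t) * (M * (x * bell (b / 2) x)) =
    x * M * (bell (b / 2) x * (2 * wbell (b / 2) t))); last by ring.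
  apply: ler_pM => //; first by rewrite mulr_ge0// ltW.
  by apply: ler_wpM2l => //; exact: ltW.
have ig : mu.-integrable `]0, +oo[ (EFin \o (fun x => M * (x * bell (b / 2) x))).
  by apply: (integrableZl _ M (integrable_mul_bell_half b20)).
have ih : mu.-integrable `]0, +oo[ (EFin \o (fun t => 2 * wbell (b / 2) t)).
  by apply: (integrableZl _ 2 (integrable_wbell b20)).
have iG := @integrable_fubini1 _ _ _ _ R mu mu _ _ m0y m0y G _ _ mG ih ig GM.
transitivity (\int[mu]_(t in `]0%R, +oo[) (\int[mu]_(x in `]0, +oo[) G (t, x))%:E)%E.
  apply: eq_integral => t; rewrite inE/= in_itv/= andbT => t0.
  rewrite /F/=; under eq_integral do rewrite EFinM.
  rewrite ge0_integralZl//; last 3 first.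
  - apply/measurable_EFinP/measurable_funTS; exact: measurable_above.
  - by move=> u _; rewrite lee_fin above_ge0.
  - by rewrite lee_fin wbell_ge0.
  rewrite integral_kinv_above// -EFinM; congr EFin.
  rewrite /kfun opprB addrCA subrr addr0.
  have cxH : continuous (fun u : R => u * hankel0 psi u) by apply: contM => //; cont.
  rewrite -RintegralZl//; last exact: continuous_locally_integrable.
  have cwxH : continuous (fun u : R => wbell b t * (u * hankel0 psi u)).
    by apply: contM => //; cont.
  have iwxH := continuous_locally_integrable 0 t cwxH.
  rewrite -Rintegral_itv_bndo_bndc; last first.
    by apply: integrableS iwxH => // u /=; rewrite !in_itv/= => /andP[-> /ltW->].
  rewrite -Rintegral_itv_obnd_cbnd; last first.
    by apply: integrableS iwxH => // u /=; rewrite !in_itv/= => /andP[/ltW-> /ltW->].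
  rewrite [LHS]Rintegral_mkcond [RHS]Rintegral_mkcond; apply: eq_Rintegral => x _.
  rewrite !patchE !mem_setE !in_itv/= andbT /G/= aboveE.
  case: (0 < x) => //=; case: (x < t); rewrite ?mulr1 ?mulr0//.
  by rewrite mulrC.
rewrite -(fineK (integrable_fin_num m0y iG))//; congr EFin.
rewrite -(Rintegral_mul_hankel0_bell cpsi psi_ge0 ipsi b0).
rewrite -[LHS]/(\int[mu]_(t in `]0, +oo[) \int[mu]_(x in `]0, +oo[) G (t, x)).
rewrite (@Rfubini _ _ _ _ R mu mu _ _ m0y m0y G _ _ mG ih ig GM)//.
apply: eq_Rintegral => x; rewrite inE/= in_itv/= andbT => x0.
rewrite -(Rintegral_wbell_above b0 (ltW x0)) -RintegralZl//.
apply: (le_integrable _ _ _ (integrable_wbell b0)) => //.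
  apply/measurable_EFinP/measurable_funTS/measurable_funM => //.
  exact: measurable_above.
move=> t _; have w0 := wbell_ge0 t b0.
have wa0 : 0 <= wbell b t * above t x by rewrite mulr_ge0 ?above_ge0.
rewrite /= lee_fin (ger0_norm wa0) (ger0_norm w0) aboveE.
by case: (x < t); rewrite ?mulr1 ?mulr0.
Qed.

End inverse_cdf.

(** * The limit density *)

Section limit_density.
Context {R : realType}.
Local Notation mu := (@lebesgue_measure R).
Variable psi : R -> R.
Hypothesis cpsi : continuous psi.
Hypothesis psi_ge0 : forall x, 0 <= psi x.
Hypothesis psiN : forall x, psi (- x) = psi x.
Hypothesis ipsi : mu.-integrable `]0, +oo[ (EFin \o psi).

Definition limit_density y := (2 * pi)^-1 * \int[mu]_x (psi x * cos (x * y)).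

Let mpsi : measurable_fun setT psi.
Proof. exact: continuous_measurable_fun. Qed.

Lemma integrable_even : mu.-integrable setT (EFin \o psi).
Proof.
apply/integrableP; split; first exact/measurable_EFinP.
under eq_integral do rewrite /= ger0_norm//.
rewrite integral_half_even// lte_mul_pinfty//.
have /integrableP[_] := ipsi.
by under eq_integral do rewrite /= ger0_norm//.
Qed.

Let cos1 (z : R) : `|cos z| <= 1. Proof. by rewrite ler_norml cos_geN1 cos_le1. Qed.

Let sin1 (z : R) : `|sin z| <= 1. Proof. by rewrite ler_norml sin_geN1 sin_le1. Qed.

Let integrable_mul (h : R -> R) : continuous h -> (forall x, `|h x| <= 1) ->
  mu.-integrable setT (EFin \o (fun x => psi x * h x)).
Proof.
move=> ch h1; apply: (le_integrable _ _ _ integrable_even) => //.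
  by apply/measurable_EFinP/measurable_funM => //; exact: continuous_measurable_fun.
by move=> x _; rewrite lee_fin/= normrM ler_piMr.
Qed.

(** The sine part vanishes because psi is even, and the two factors (2 pi)^(-1/2) combine. *)
Lemma limit_density_fourier1 y :
  ((limit_density y)%:C = ((Num.sqrt (2 * pi))^-1)%:C * fourier1 psi y)%C.
Proof.
rewrite /fourier1 /Cintegral /expi.
have cs : continuous (fun x : R => sin (- (x * y))) by cont.
have odd0 : \int[mu]_x (psi x * sin (- (x * y))) = 0.
  have h := Rintegral_affine 0 (_ : -1 != 0 :> R) (integrable_mul cs (fun x => sin1 _)).
  suff /eqP : \int[mu]_x (psi x * sin (- (x * y))) = - \int[mu]_x (psi x * sin (- (x * y))).
    by rewrite -addr_eq0 -mulr2n mulrn_eq0 => /orP[]// /eqP.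
  rewrite {1}h ?oppr_eq0 ?oner_neq0// normrN1 mul1r.
  transitivity (\int[mu]_x (-1 * (psi x * sin (- (x * y))))).
    apply: eq_Rintegral => x _.
    by rewrite [RHS]mulN1r [in RHS]sinN mulrN opprK addr0 mulN1r psiN mulNr opprK.
  by rewrite RintegralZl ?mulN1r//; exact: integrable_mul.
have -> : \int[mu]_x complex.Im ((psi x)%:C * (cos (- (x * y)) +i* sin (- (x * y))))%C = 0.
  rewrite -[RHS]odd0; apply: eq_Rintegral => x _ /=.
  by rewrite mul0r addr0.
have -> : \int[mu]_x complex.Re ((psi x)%:C * (cos (- (x * y)) +i* sin (- (x * y))))%C =
    \int[mu]_x (psi x * cos (x * y)).
  by apply: eq_Rintegral => x _ /=; rewrite mul0r subr0 cosN.
have tp0 : (0 : R) <= 2 * pi by rewrite mulr_ge0// pi_ge0.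
apply/eqP; rewrite eq_complex /= !(mul0r, mulr0, addr0, subr0) eqxx andbT.
by rewrite /limit_density mulrA -invfM -expr2 sqr_sqrtr.
Qed.

Lemma continuous_limit_density : continuous limit_density.
Proof.
apply: contM; first by cont.
move=> z; have zI : z \in `]z - 1, z + 1[%classic by rewrite inE/= in_itv/=; lra.
apply: (@continuity_under_integral _ _ _ mu (fun y x => psi x * cos (x * y)) setT _
  (z - 1) (z + 1) _ _ psi) => //.
- by move=> u _; apply: integrable_mul => //; cont.
- apply: aeW => x _ u _.
  have : continuous (fun y => psi x * cos (x * y)) by cont.
  exact.
- exact: integrable_even.
- by move=> u _; apply: aeW => x _; rewrite normrM ger0_norm// ler_piMr.
Qed.

Lemma norm_limit_density_le y : `|limit_density y| <= (2 * pi)^-1 * \int[mu]_x psi x.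
Proof.
have tp0 : (0 : R) <= (2 * pi)^-1 by rewrite invr_ge0 mulr_ge0// pi_ge0.
rewrite normrM (ger0_norm tp0); apply: ler_wpM2l => //.
have i : mu.-integrable setT (EFin \o (fun x => psi x * cos (x * y))).
  by apply: integrable_mul => //; cont.
rewrite (le_trans (le_normr_Rintegral _ i))//.
apply: le_Rintegral => //.
- exact: integrable_abse i.
- exact: integrable_even.
- by move=> x _; rewrite normrM ger0_norm// ler_piMr.
Qed.

Lemma limit_densityN y : limit_density (- y) = limit_density y.
Proof.
congr (_ * _); apply: eq_Rintegral => x _.
by rewrite mulrN cosN.
Qed.

Lemma integrable_mul_bell_psi b : 0 < b ->
  mu.-integrable setT (EFin \o (fun x => psi x * bell b x)).
Proof.
move=> b0; apply: integrable_mul; first exact: continuous_bell.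
by move=> x; rewrite ger0_norm ?bell_ge0// bell_le1// ltW.
Qed.

(** Fubini moves the cosine transform from [psi] to the Gaussian, where [bell_fourier] applies;
    evenness of [psi] folds the line onto the half-line. *)
Lemma Rintegral_bell_limit_density b : 0 < b ->
  \int[mu]_y (bell b y * limit_density y) =
  pi^-1 * Num.sqrt (2 * pi / b) * \int[mu]_(x in `]0, +oo[) (psi x * bell b^-1 x).
Proof.
move=> b0; have b10 : 0 < b^-1 by rewrite invr_gt0.
pose F (z : R * R) := (2 * pi)^-1 * (psi z.2 * (bell b z.1 * cos (z.2 * z.1))).
have mF : measurable_fun setT F.
  have m1 : measurable_fun setT (fun z : R * R => psi z.2) by exact: measurableT_comp.
  have m2 : measurable_fun setT (fun z : R * R => bell b z.1).
    exact: measurableT_comp (measurable_bell b) _.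
  by rewrite /F; meas.
have tp0 : (0 : R) <= (2 * pi)^-1 by rewrite invr_ge0 mulr_ge0// pi_ge0.
have mT : measurable (setT : set (measurableTypeR R)) by [].
have ig := integrable_bell b0.
have ih : mu.-integrable setT (EFin \o (fun x => (2 * pi)^-1 * psi x)).
  exact: (integrableZl measurableT _ integrable_even).
have Fle x y : setT x -> setT y -> `|F (x, y)| <= bell b x * ((2 * pi)^-1 * psi y).
  move=> _ _; rewrite /F/= !normrM (ger0_norm tp0) (ger0_norm (psi_ge0 _)) (ger0_norm (bell_ge0 _ _)).
  rewrite (_ : bell b x * _ = (2 * pi)^-1 * (psi y * (bell b x * 1))); last by ring.
  by do 2 apply: ler_wpM2l => //; apply: ler_wpM2l => //; exact: bell_ge0.
transitivity (\int[mu]_y \int[mu]_x F (y, x)).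
  apply: eq_Rintegral => y _; rewrite /limit_density mulrCA -RintegralZl//; last first.
    by apply: integrable_mul => //; cont.
  rewrite -RintegralZl//; last first.
    have ic : mu.-integrable setT (EFin \o (fun x => psi x * cos (x * y))).
      by apply: integrable_mul => //; cont.
    exact: (integrableZl measurableT (bell b y) ic).
  by apply: eq_Rintegral => x _; rewrite /F/=; congr (_ * _); exact: mulrCA.
rewrite (@Rfubini _ _ _ _ R mu mu _ _ mT mT F _ _ mF ig ih Fle).
have ib := integrable_mul_bell_psi b10.
transitivity ((2 * pi)^-1 * Num.sqrt (2 * pi / b) * \int[mu]_x (psi x * bell b^-1 x)).
  rewrite -RintegralZl//; apply: eq_Rintegral => x _.
  transitivity ((2 * pi)^-1 * psi x * \int[mu]_y (bell b y * cos (x * y))).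
    rewrite -RintegralZl//; last first.
      by apply: integrable_bell_mul => //; cont.
    by apply: eq_Rintegral => y _; exact: mulrA.
  by rewrite bell_fourier//; ring.
have -> : \int[mu]_x (psi x * bell b^-1 x) = 2 * \int[mu]_(x in `]0, +oo[) (psi x * bell b^-1 x).
  rewrite /Rintegral integral_half_even.
  - rewrite fineM//; apply: (integrable_fin_num _ (integrableS measurableT _ _ ib)) => //.
  - by apply: contM => //; exact: continuous_bell.
  - by move=> x; rewrite mulr_ge0// bell_ge0.
  - by move=> x; rewrite psiN bellN.
have pi0 : (pi : R) != 0 by rewrite gt_eqF// pi_gt0.
rewrite mulrA; congr (_ * _); rewrite invfM; move: pi0.
by generalize (Num.sqrt (2 * pi / b)); generalize (pi : R) => p s p0; field.
Qed.

End limit_density.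

(** * Gaussian means of K(U) sin(S) *)

Section mixture.
Context {R : realType}.
Local Notation mu := (@lebesgue_measure R).
Variable psi : R -> R.
Hypothesis cpsi : continuous psi.
Hypothesis psi_ge0 : forall x, 0 <= psi x.
Hypothesis psiN : forall x, psi (- x) = psi x.
Hypothesis ipsi : mu.-integrable `]0, +oo[ (EFin \o psi).
Hypothesis ixpsi : mu.-integrable `]0, +oo[ (fun r => (r * psi r)%:E).
Hypothesis k_bij : set_bij `]0, +oo[ `]0, 1[ (kfun psi).

Let K := kinv psi.

Let mpsi : measurable_fun setT psi.
Proof. exact: continuous_measurable_fun. Qed.

Let mK : measurable_fun setT K := measurable_kinv cpsi psi_ge0 ixpsi k_bij.

Let q (x : R) := (1 + x ^+ 2)^-1.

Let q_gt0 x : 0 < q x.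
Proof. by rewrite /q invr_gt0 ltr_pwDl// sqr_ge0. Qed.

Let mq : measurable_fun setT q.
Proof. by apply: continuous_measurable_fun; exact: continuous_inv1Dsqr. Qed.

Let m0y : measurable (`]0, +oo[%classic : set (measurableTypeR R)).
Proof. by []. Qed.

Let m01 : measurable (`]0, 1[%classic : set (measurableTypeR R)).
Proof. by []. Qed.

Let integral_bell_sin b k : 0 < b ->
  (\int[mu]_(s in `[(- pi)%R, pi%R]) (bell b (k * sin s))%:E =
   \int[mu]_(x in `]0%R, +oo[) (4 * (bell (b * q x) k * q x))%:E)%E.
Proof.
move=> b0; pose g w := bell (b * w) k.
have cg : continuous g by rewrite /g /bell; cont.
have h := integral_circle_atan cg (fun w => bell_ge0 _ _).
have cb : continuous (fun s => bell b (k * sin s)) by rewrite /bell; cont.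
under [RHS]eq_integral do rewrite EFinM.
rewrite ge0_integralZl//; last 2 first.
- apply/measurable_EFinP/measurable_funTS/measurable_funM => //.
  by rewrite /bell; meas.
- by move=> x _; rewrite lee_fin mulr_ge0 ?bell_ge0// ltW.
rewrite [X in (_ = _ * X)%E]h -EFinM mulrA mulfV// mul1r.
rewrite -[LHS]fineK; last first.
  by apply: integrable_fin_num => //; exact: continuous_locally_integrable.
congr EFin; apply: eq_Rintegral => s _.
by rewrite /g /bell; congr expR; rewrite exprMn; ring.
Qed.

Let integrable_xpsi_bell c : 0 < c ->
  mu.-integrable `]0, +oo[ (EFin \o (fun r => r * psi r * bell c r)).
Proof.
move=> c0; apply: (le_integrable _ _ _ ixpsi) => //.
  apply/measurable_EFinP/measurable_funTS/measurable_funM; last exact: measurable_bell.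
  exact: measurable_funM.
move=> r _; rewrite lee_fin/= normrM ler_piMr// ger0_norm ?bell_ge0// bell_le1//.
exact: ltW.
Qed.

(** Because 1/q(x) = 1 + x^2, the exponent splits into a part in r alone and a Gaussian in x of
    parameter r^2/b. *)
Let bell_split (b x r : R) :
  bell (b * q x)^-1 r = bell b^-1 r * bell (b^-1 * r ^+ 2) x.
Proof. by rewrite /bell -expRD; congr expR; rewrite invfM /q invrK; ring. Qed.

(** At fixed x the factor 1/(b q(x)) from [integral_bell_kinv] cancels the density q(x) and leaves
    1/b. *)
Let integral_q_bell b : 0 < b ->
  (\int[mu]_(x in `]0%R, +oo[) \int[mu]_(u in `]0%R, 1%R[) (4 * (bell (b * q x) (K u) * q x))%:E =
   \int[mu]_(x in `]0%R, +oo[) \int[mu]_(r in `]0%R, +oo[)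
     (4 / b * (`|r| * psi r * bell b^-1 r) * bell (b^-1 * r ^+ 2) x)%:E)%E.
Proof.
move=> b0; apply: eq_integral => x _.
have qx := q_gt0 x; have bq0 : 0 < b * q x by rewrite mulr_gt0.
transitivity (\int[mu]_(u in `]0%R, 1%R[) ((4 * q x)%:E * (bell (b * q x) (K u))%:E))%E.
  by apply: eq_integral => u _; rewrite -EFinM; congr EFin; ring.
rewrite ge0_integralZl//; last 3 first.
- by apply/measurable_EFinP/measurable_funTS; exact: measurableT_comp (measurable_bell _) mK.
- by move=> u _; rewrite lee_fin bell_ge0.
- by rewrite lee_fin mulr_ge0// ltW.
rewrite (integral_bell_kinv cpsi psi_ge0 ixpsi k_bij bq0) -EFinM.
have bqV0 : 0 < (b * q x)^-1 by rewrite invr_gt0.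
have ib := integrable_xpsi_bell bqV0.
transitivity (\int[mu]_(r in `]0%R, +oo[) (4 / b * (r * psi r * bell (b * q x)^-1 r))%:E)%E.
  have i2 := integrableZl m0y (4 / b) ib.
  rewrite -[RHS]fineK; last exact: (integrable_fin_num m0y i2).
  congr EFin; rewrite [RHS](RintegralZl _ m0y ib)//.
  rewrite mulrA; congr (_ * _); rewrite invfM; field.
  by rewrite !gt_eqF.
apply: eq_integral => r; rewrite inE/= in_itv/= andbT => r0; rewrite (gtr0_norm r0).
congr EFin; rewrite -[RHS]mulrA; congr (_ * _); rewrite -[RHS]mulrA; congr (_ * _).
exact: bell_split.
Qed.

Let sqrt_bell_mass (b r : R) : 0 < b -> 0 < r ->
  Num.sqrt (2 * pi / (b^-1 * r ^+ 2)) = b / r * Num.sqrt (2 * pi / b).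
Proof.
move=> b0 r0.
have -> : 2 * pi / (b^-1 * r ^+ 2) = (b / r) ^+ 2 * (2 * pi / b).
  by generalize (pi : R) => p; field; rewrite !gt_eqF.
by rewrite sqrtrM ?sqr_ge0// sqrtr_sqr ger0_norm// divr_ge0// ltW.
Qed.

(** The x-integral goes outside to apply the law of K(U), then inside again, where the Gaussian of
    parameter r^2/b has mass proportional to 1/r and cancels the weight r. *)
Lemma integral_bell_mixture b : 0 < b ->
  (\int[mu]_(u in `]0%R, 1%R[) \int[mu]_(s in `[(- pi)%R, pi%R]) (bell b (K u * sin s))%:E =
   (2 * Num.sqrt (2 * pi / b) * \int[mu]_(r in `]0, +oo[) (psi r * bell b^-1 r))%:E)%E.
Proof.
move=> b0; have b10 : 0 < b^-1 by rewrite invr_gt0.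
under eq_integral do rewrite integral_bell_sin//.
pose F (z : R * R) := (4 * (bell (b * q z.2) (K z.1) * q z.2))%:E.
have mF : measurable_fun setT F.
  have m1 : measurable_fun setT (fun z : R * R => q z.2) by exact: measurableT_comp mq _.
  have m2 : measurable_fun setT (fun z : R * R => K z.1) by exact: measurableT_comp mK _.
  by apply/measurable_EFinP; rewrite /F /bell; meas.
have F0 z : (0 <= F z)%E.
  by rewrite lee_fin; apply: mulr_ge0 => //; rewrite mulr_ge0 ?bell_ge0// ltW.
rewrite (tonelli mu mu m01 m0y mF F0) [LHS]integral_q_bell//.
pose G (z : R * R) :=
  (4 / b * (`|z.2| * psi z.2 * bell b^-1 z.2) * bell (b^-1 * z.2 ^+ 2) z.1)%:E.
have mG : measurable_fun setT G.
  have m1 : measurable_fun setT (fun z : R * R => psi z.2) by exact: measurableT_comp.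
  have m2 : measurable_fun setT (fun z : R * R => `|z.2|) by exact: measurableT_comp.
  by apply/measurable_EFinP; rewrite /G /bell; meas.
have b40 : 0 <= 4 / b by rewrite divr_ge0// ltW.
have c0 r : 0 <= 4 / b * (`|r| * psi r * bell b^-1 r).
  by apply: mulr_ge0 => //; apply: mulr_ge0; [exact: mulr_ge0|exact: bell_ge0].
have G0 z : (0 <= G z)%E by rewrite lee_fin mulr_ge0// bell_ge0.
rewrite (tonelli mu mu m0y m0y mG G0).
transitivity (\int[mu]_(r in `]0%R, +oo[)
    (2 * Num.sqrt (2 * pi / b) * (psi r * bell b^-1 r))%:E)%E.
  apply: eq_integral => r; rewrite inE/= in_itv/= andbT => r0.
  have br0 : 0 < b^-1 * r ^+ 2 by rewrite mulr_gt0// exprn_gt0.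
  rewrite /G/=; under eq_integral do rewrite EFinM.
  rewrite ge0_integralZl//; last 3 first.
  - by apply/measurable_EFinP/measurable_funTS; exact: measurable_bell.
  - by move=> x _; rewrite lee_fin bell_ge0.
  - by rewrite lee_fin.
  rewrite integral_bell_half// -EFinM; congr EFin.
  rewrite sqrt_bell_mass// gtr0_norm//.
  have alg (p v w x : R) : 0 < x ->
      4 / b * (x * v * w) * (2^-1 * (b / x * p)) = 2 * p * (v * w).
    by move=> x0; field; rewrite !gt_eqF.
  exact: alg.
have ib : mu.-integrable `]0, +oo[ (EFin \o (fun r => psi r * bell b^-1 r)).
  by apply: integrableS (integrable_mul_bell_psi cpsi psi_ge0 psiN ipsi b10).
have i2 := integrableZl m0y (2 * Num.sqrt (2 * pi / b)) ib.
rewrite -[LHS]fineK; last exact: (integrable_fin_num m0y i2).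
by congr EFin; rewrite [LHS](RintegralZl _ m0y ib).
Qed.

End mixture.

(** * Random variables *)

Section as_mfun.
Context d d' (T : measurableType d) (T' : measurableType d') (f : T -> T').
Hypothesis mf : measurable_fun setT f.

(** A named copy of [f] to which the measurable-function structure can be attached. *)
Definition fun_of_measurable := f.

HB.instance Definition _ := isMeasurableFun.Build _ _ _ _ fun_of_measurable mf.

Definition as_mfun : {mfun T >-> T'} := fun_of_measurable.

End as_mfun.

Section bounded_expectation.
Context d (T : measurableType d) (R : realType) (P : probability T R).
Variables (X : {RV P >-> R}) (g : R -> R) (M : R).
Hypothesis cg : continuous g.
Hypothesis gM : forall x, `|g x| <= M.

Let integrable_bounded : P.-integrable setT (fun w => (g (X w))%:E).
Proof.
apply: (le_integrable _ _ _ (finite_measure_integrable_cst P M measurableT)) => //.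
  by apply/measurable_EFinP; exact: measurable_cont_comp.
by move=> w _; rewrite lee_fin/= (le_trans (gM _))// ler_norm.
Qed.

Lemma bounded_expectation_fin_num : ('E_P[g \o X])%E \is a fin_num.
Proof. by rewrite unlock; apply: integrable_fin_num. Qed.

Lemma expectation_addr (c : R) : ('E_P[(fun x => g x + c)%R \o X] = 'E_P[g \o X] + c%:E)%E.
Proof.
rewrite unlock /=; under eq_integral do rewrite EFinD.
rewrite integralD//; last exact: finite_measure_integrable_cst.
by rewrite integral_cst//= probability_setT mule1.
Qed.

End bounded_expectation.

Section cvg_in_law_ge0.
Context (R : realType) d (T : measurableType d) (P : probability T R)
  (X : nat -> {RV P >-> R})
  d' (T' : measurableType d') (P' : probability T' R) (Y : {RV P' >-> R}).

(** A bounded test function becomes nonnegative after adding a constant, which shifts both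
    expectations equally; integrals of nonnegative functions then suffice. *)
Lemma cvg_in_law_ge0 :
  (forall (g : R -> R) (M : R), continuous g -> (forall x, `|g x| <= M) -> (forall x, 0 <= g x) ->
    ('E_P[g \o X n] @[n --> \oo] --> 'E_P'[g \o Y])%E) ->
  cvg_in_law X Y.
Proof.
move=> cvg0 g cg [M [_ gb]].
(* [bounded_fun] gives a bound for each value beyond [M], hence [M + 1]. *)
have gM x : `|g x| <= M + 1 by apply: gb => //; rewrite ltrDl.
pose h x := g x + (M + 1).
have ch : continuous h by apply: contD => //; cont.
have h0 x : 0 <= h x by have := gM x; rewrite ler_norml => /andP[+ _]; rewrite /h; lra.
have hM x : `|h x| <= M + 1 + (M + 1).
  rewrite ger0_norm// /h lerD2r.
  by rewrite (le_trans (ler_norm _)).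
have E d0 (T0 : measurableType d0) (P0 : probability T0 R) (Z : {RV P0 >-> R}) :
    ('E_P0[g \o Z] = 'E_P0[h \o Z] - (M + 1)%:E)%E.
  by rewrite (expectation_addr Z cg gM) addeK.
rewrite E; under eq_fun do rewrite E.
apply: cvgeB; [by rewrite fin_num_adde_defl| |exact: cvg_cst].
exact: cvg0 ch hM h0.
Qed.

End cvg_in_law_ge0.

Lemma distribution_indic d (T : measurableType d) (R : realType) (P : probability T R)
    (X : {RV P >-> R}) (B : set R) : measurable B ->
  (distribution P X B = \int[P]_w (\1_B (X w) : R)%:E)%E.
Proof.
move=> mB; have mX : measurable (X @^-1` B) by exact: measurable_funPTI.
by rewrite -[RHS]/(\int[P]_w (\1_(X @^-1` B) w)%:E)%E integral_indic// setIT.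
Qed.

Section uniform_variables.
Context {R : realType}.
Local Notation mu := (@lebesgue_measure R).

Lemma ge0_integral_uniform01 d (T : measurableType d) (P : probability T R) (U : {RV P >-> R})
    (f : R -> \bar R) :
  (forall A, measurable A -> distribution P U A = uniform_prob (@ltr01 R) A) ->
  measurable_fun setT f -> (forall x, 0 <= f x)%E ->
  (\int[P]_w f (U w) = \int[mu]_(u in `]0%R, 1%R[) f u)%E.
Proof.
move=> U_unif mf f0.
(* [U] is recast with values in the type that carries Lebesgue measure. *)
have mU : @measurable_fun _ _ T (measurableTypeR R) setT U.
  by move=> mT Y mY; exact: (@measurable_funPT _ _ _ _ U mT Y).
pose U' : {RV P >-> measurableTypeR R} := as_mfun mU.
have mf' : measurable_fun (setT : set (measurableTypeR R)) f by exact: mf.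
transitivity (\int[uniform_prob (@ltr01 R)]_y f y)%E.
  rewrite -[LHS]/(\int[P]_w (f \o U') w)%E -[LHS](ge0_integral_distribution U' mf' f0).
  apply: eq_measure_integral => A mA _.
  have mA' : measurable (A : set R) by exact: mA.
  exact: (U_unif A mA').
rewrite integral_uniform// subr0 invr1 mul1e.
by rewrite integral_itv_bndoo//; exact: measurable_funTS.
Qed.

Lemma npi_lt_pi : - pi < pi :> R.
Proof. by have := pi_gt0 R; lra. Qed.

(** The joint law of U and an independent uniform phase S, as found in the limit of
    [equidistribution]. *)
Definition torus_prob : probability (measurableTypeR R * measurableTypeR R)%type R :=
  (uniform_prob (@ltr01 R) \x uniform_prob npi_lt_pi)%E.

Lemma ge0_integral_torus (F : R * R -> \bar R) : measurable_fun setT F ->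
  (forall z, 0 <= F z)%E ->
  (\int[torus_prob]_z F z =
   (2 * pi)^-1%:E * \int[mu]_(u in `]0%R, 1%R[) \int[mu]_(s in `[(- pi)%R, pi%R]) F (u, s))%E.
Proof.
move=> mF F0; have pi0 := pi_gt0 R.
have tp0 : (2 * pi : R) != 0 by rewrite gt_eqF// mulr_gt0.
rewrite fubini_tonelli1//.
set G := fubini_F _ _.
have mG : measurable_fun setT G by exact: measurable_fun_fubini_tonelli_F.
have G0 u : (0 <= G u)%E by apply: integral_ge0 => s _; exact: F0.
have GE u : (\int[mu]_(s in `[(- pi)%R, pi%R]) F (u, s) = (2 * pi)%:E * G u)%E.
  rewrite /G /fubini_F integral_uniform//; last first.
    exact: measurable_fun_pair2.
  rewrite (_ : pi - - pi = 2 * pi); last by ring.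
  by rewrite muleA -EFinM mulfV// mul1e.
rewrite [X in (_ * X)%E](eq_integral (fun u => (2 * pi)%:E * G u)%E); last by move=> u _; exact: GE.
rewrite integral_uniform// subr0 invr1 mul1e integral_itv_bndoo; last exact: measurable_funTS.
rewrite ge0_integralZl//; last 2 first.
- exact: measurable_funTS.
- by rewrite lee_fin mulr_ge0// ltW.
by rewrite muleA -EFinM mulVf// mul1e.
Qed.

End uniform_variables.

(** * The limit variable and its symmetry *)

Section torus_variable.
Context {R : realType}.
Local Notation mu := (@lebesgue_measure R).
Variable K : R -> R.
Hypothesis mK : measurable_fun setT K.

Let mV : measurable_fun [set: (measurableTypeR R * measurableTypeR R)%type]
  ((fun z => K z.1 * sin z.2) : _ -> R).
Proof.
have mV : measurable_fun setT (fun z : R * R => K z.1 * sin z.2).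
  have mK1 : measurable_fun setT (fun z : R * R => K z.1) by exact: measurableT_comp mK _.
  by meas.
exact: mV.
Qed.

Definition torus_RV : {RV (@torus_prob R) >-> R} := as_mfun mV.

Lemma ge0_integral_torus_RV (f : R -> \bar R) : measurable_fun setT f ->
  (forall y, 0 <= f y)%E ->
  (\int[@torus_prob R]_z f (torus_RV z) =
   (2 * pi)^-1%:E * \int[mu]_(u in `]0%R, 1%R[) \int[mu]_(s in `[(- pi)%R, pi%R]) f (K u * sin s)%R)%E.
Proof.
move=> mf f0.
have mF : measurable_fun setT (fun z : R * R => f (K z.1 * sin z.2)).
  exact: (measurableT_comp mf mV).
exact: (ge0_integral_torus mF (fun z => f0 _)).
Qed.

(** Reflecting s -> -s changes the sign of the sine and preserves [-pi, pi]. *)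
Lemma distribution_torus_RVN (A : set R) : measurable A ->
  distribution (@torus_prob R) torus_RV (-%R @^-1` A) =
  distribution (@torus_prob R) torus_RV A.
Proof.
move=> mA; have mo : measurable_fun setT (-%R : R -> R).
  by apply: continuous_measurable_fun; exact: opp_continuous.
have mNA : measurable (-%R @^-1` A).
  by rewrite -[X in measurable X]setTI; exact: mo.
pose f (y : R) := (\1_A y : R)%:E.
have mf : measurable_fun setT f by apply/measurable_EFinP; exact: measurable_indic.
have f0 y : (0 <= f y)%E by rewrite lee_fin.
have mfN : measurable_fun setT (fun y : R => f (- y)) by exact: measurableT_comp mf mo.
rewrite [LHS]distribution_indic// [RHS]distribution_indic//.
rewrite [RHS](ge0_integral_torus_RV mf f0).
rewrite [LHS](ge0_integral_torus_RV mfN (fun y => f0 _)).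
congr (_ * _)%E; apply: eq_integral => u _.
have mS : measurable_fun setT (fun s : R => f (K u * sin s)).
  by apply: (measurableT_comp mf); meas.
rewrite [RHS]integral_mkcond (ge0_integral_affine (a := -1) 0).
- rewrite normrN1 mul1e integral_mkcond; apply: eq_integral => s _.
  rewrite !patchE addr0 mulN1r sinN mulrN !mem_setE !in_itv/=.
  by rewrite lerN2 lerNl andbC.
- by rewrite oppr_eq0 oner_neq0.
- have h := measurable_restrictT (fun s : R => f (K u * sin s)) (@measurable_itv R `[- pi, pi]).
  by apply/h; exact: measurable_funTS.
- by move=> s; rewrite patchE; case: ifPn.
Qed.

End torus_variable.

(** * Convergence in law and density of the limit *)

Local Open Scope complex_scope.

Theorem theorem2p5 (R : realType) (psi : R -> R)
    (psi_C1 : C1 psi)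
    (psi_L1 : lebesgue_measure.-integrable `]0, +oo[ (EFin \o psi))
    (sqrt_psi_L1 :
      lebesgue_measure.-integrable `]0, +oo[ (fun t => (Num.sqrt t * psi t)%:E))
    (id_psi_L1 : lebesgue_measure.-integrable `]0, +oo[ (fun t => (t * psi t)%:E))
    (psi_even : forall x, psi (- x) = psi x)
    (psi_ge0 : forall x, 0 <= psi x)
    (psi0 : psi 0 = 1)
    (k_bij : set_bij `]0, +oo[ `]0, 1[ (kfun psi))
    (kinv_L1loc : locally_integrable `]0, 1[ (kinv psi))
    (d : measure_display) (T : measurableType d) (P : probability T R)
    (U : {RV P >-> R})
    (U_unif : forall A, measurable A ->
      distribution P U A = uniform_prob (@ltr01 R) A) :
  exists (V_ : nat -> {RV P >-> R})
         (d' : measure_display) (T' : measurableType d') (P' : probability T' R)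
         (V : {RV P' >-> R}) (f : R -> R),
    [/\ forall n w, V_ n w = kinv psi (U w) * sin (n%:R * U w),
        cvg_in_law V_ V,
        has_density V f &
        forall y, (f y)%:C = ((Num.sqrt (2 * pi))^-1)%:C * fourier1 psi y].
Proof.
pose mu := @lebesgue_measure R.
have cpsi : continuous psi.
  move=> x; apply/differentiable_continuous/derivable1_diffP.
  by case: psi_C1.
have mK := measurable_kinv cpsi psi_ge0 id_psi_L1 k_bij.
have cK := continuous_kinv cpsi psi_ge0 id_psi_L1 k_bij.
set K := kinv psi in mK cK *.
have mVn n : measurable_fun setT (fun w => K (U w) * sin (n%:R * U w)).
  have mKU : measurable_fun setT (fun w => K (U w)) by exact: measurableT_comp mK _.
  have mU : measurable_fun setT U by [].
  by meas.
pose V := torus_RV mK.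
have f_density : has_density V (limit_density psi).
  have cf := continuous_limit_density cpsi psi_ge0 psi_even psi_L1.
  have fC := norm_limit_density_le cpsi psi_ge0 psi_even psi_L1.
  have fN := limit_densityN psi.
  pose nu : probability R R := distribution (@torus_prob R) V.
  have nuN := distribution_torus_RVN mK.
  (* The factor (2 pi)^-1 of the uniform phase times 2 sqrt(2 pi/b) from the mixture equals the
     constant of [Rintegral_bell_limit_density]. *)
  have nu_bell b : 0 < b -> \int[nu]_y bell b y = \int[mu]_y (bell b y * limit_density psi y).
    move=> b0; rewrite (Rintegral_bell_limit_density cpsi psi_ge0 psi_even psi_L1 b0).
    have mb : measurable_fun setT (EFin \o (@bell R b)).
      by apply/measurable_EFinP; exact: measurable_bell.
    have bb0 y : (0 <= (EFin \o @bell R b) y)%E by rewrite lee_fin bell_ge0.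
    rewrite [LHS]/Rintegral (ge0_integral_distribution V mb bb0).
    have /= -> := ge0_integral_torus_RV mK mb bb0.
    rewrite (integral_bell_mixture cpsi psi_ge0 psi_even psi_L1 id_psi_L1 k_bij b0).
    rewrite -EFinM /=.
    have := pi_gt0 R; generalize (pi : R) => p p0.
    set s := Num.sqrt _; set J := Rintegral _ _ _.
    by field; rewrite gt_eqF.
  have f0 := gaussian_test_ge0 cf fC fN nu_bell.
  have fd := gaussian_test_density cf fC fN nuN nu_bell.
  split => //; first exact: continuous_measurable_fun.
exists (fun n => as_mfun (mVn n)), _, _, (@torus_prob R), V, (limit_density psi); split => //.
- apply: cvg_in_law_ge0 => g M cg gM g0.
  have mg : measurable_fun setT (EFin \o g).
    by apply/measurable_EFinP; exact: continuous_measurable_fun.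
  have EX n : ('E_P[g \o as_mfun (mVn n)] = (\int[mu]_(u in `]0, 1[) g (K u * sin (n%:R * u)))%:E)%E.
    have fin := @bounded_expectation_fin_num _ _ _ P (as_mfun (mVn n)) _ _ cg gM.
    rewrite -(fineK fin) unlock; congr EFin.
    have mh : measurable_fun setT (fun u : R => (g (K u * sin (n%:R * u)))%:E).
      by apply: (measurableT_comp mg); meas.
    have h0 (u : R) : (0 <= (g (K u * sin (n%:R * u)))%:E)%E by rewrite lee_fin.
    by have /= -> := ge0_integral_uniform01 U_unif mh h0.
  have EV : ('E_(@torus_prob R)[g \o V] = ((2 * pi)^-1 *
      \int[mu]_(u in `]0, 1[) \int[mu]_(s in `[- pi, pi]) g (K u * sin s))%:E)%E.
    have fin := @bounded_expectation_fin_num _ _ _ (@torus_prob R) V _ _ cg gM.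
    have g0' y : (0 <= (EFin \o g) y)%E by rewrite lee_fin.
    have h := ge0_integral_torus_RV mK mg g0'.
    have {}h : ('E_(@torus_prob R)[g \o V] = (2 * pi)^-1%:E *
       \int[mu]_(u in `]0%R, 1%R[) (\int[mu]_(s in `[- pi, pi]) g (K u * sin s))%:E)%E.
      rewrite unlock [LHS]h; congr (_ * _)%E; apply: eq_integral => u _.
      rewrite /Rintegral fineK//; apply: integrable_fin_num => //.
      apply: continuous_locally_integrable.
      by apply: (@continuous_comp1 _ (fun s => K u * sin s)) => //; cont.
    have tp0 : (2 * pi : R) != 0 by rewrite gt_eqF// mulr_gt0// pi_gt0.
    move: h; set X := (\int[mu]_(u in _) _)%E => h.
    (* The expectation of a bounded function is finite, hence so is X, and the identity descends to
       real numbers. *)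
    have XE : X = ((2 * pi)%:E * 'E_(@torus_prob R)[g \o V])%E.
      by rewrite h muleA -EFinM mulfV// mul1e.
    have fX : X \is a fin_num by rewrite XE fin_numM.
    by rewrite h -[in LHS](fineK fX) -EFinM.
  rewrite EV (funext EX); apply: cvg_EFin; first exact: nearW.
  exact: equidistribution cK mK cg gM.
- by move=> y; rewrite limit_density_fourier1.
Qed.
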